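(* For all finite filtered spaces $\mathbf{X}=(X,F_X)$ and $\mathbf{Y}=(Y,F_Y)$, and all integers $k\ge 0$, one has $$d_{\mathcal{D}}\big(\mathrm{D}_k(\mathbf{X}),\mathrm{D}_k(\mathbf{Y})\big)\leq d_{\mathcal{F}}(\mathbf{X},\mathbf{Y}).$$
   Context: Filtered spaces. For a finite set $X$, $\mathrm{pow}(X)$ denotes the set of nonempty subsets of $X$. A (finite) filtered space is a pair $\mathbf{X}=(X,F_X)$ where $X$ is a nonempty finite set and $F_X:\mathrm{pow}(X)\to\mathbb{R}$ is monotone, i.e. $F_X(\sigma)\ge F_X(\tau)$ whenever $\sigma\supseteq\tau$; $F_X$ is called a filtration over $X$. $\mathcal{F}$ denotes the collection of all finite filtered spaces. The distance $d_{\mathcal{F}}$. A parametrization of a finite set $X$ is a finite set $Z$ together with a surjective map $\varphi_X:Z\to X$. The pullback filtration is $\varphi_X^*F_X:\mathrm{pow}(Z)\to\mathbb{R}$, $\tau\mapsto F_X(\varphi_X(\tau))$. For $\mathbf{X}=(X,F_X)$, $\mathbf{Y}=(Y,F_Y)$ in $\mathcal{F}$, $$d_{\mathcal{F}}(\mathbf{X},\mathbf{Y}):=\inf\Big\{\max_{\tau\in\mathrm{pow}(Z)}\big|\varphi_X^*F_X(\tau)-\varphi_Y^*F_Y(\tau)\big|\Big\},$$ where the infimum is over all finite sets $Z$ and all pairs of surjective maps $\varphi_X:Z\to X$, $\varphi_Y:Z\to Y$. Persistence diagrams. Fix a field $\mathbb{F}$; all homology is (unreduced) simplicial homology with coefficients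 in $\mathbb{F}$. For $\mathbf{X}=(X,F_X)\in\mathcal{F}$ and $\varepsilon\in\mathbb{R}$, let $L_\varepsilon(\mathbf{X}):=\{\sigma\in\mathrm{pow}(X): F_X(\sigma)\le\varepsilon\}$, a finite simplicial complex (possibly empty). For an integer $k\ge0$, the inclusions $L_\varepsilon(\mathbf{X})\subseteq L_{\varepsilon'}(\mathbf{X})$, $\varepsilon\le\varepsilon'$, induce the persistence vector space $\mathbb{V}_k(\mathbf{X})=\{H_k(L_\varepsilon(\mathbf{X}))\to H_k(L_{\varepsilon'}(\mathbf{X}))\}_{\varepsilon\le\varepsilon'}$. It is classified up to isomorphism by a finite multiset of intervals $[b,d)$ with $b\in\mathbb{R}$, $b<d\le\infty$ (the intervals in its decomposition into interval modules). $\mathrm{D}_k(\mathbf{X})$ (also written $\mathrm{D}_k(F_X)$) is the corresponding finite multiset of points $(b,d)$, the $k$-th persistence diagram. Bottleneck distance. For $P=(x_P,y_P)$ with $x_P\le y_P$, put $\mathrm{pers}(P):=y_P-x_P$ (equal to $\infty$ if $y_P=\infty$). In $\|P-Q\|_\infty$ use the conventions $|\infty-\infty|=0$ and $|\infty-a|=\infty$ for $a\in\mathbb{R}$; a maximum over the empty set is $0$. For finite persistence diagrams $D_1=\{P_\alpha\}_{\alpha\in A_1}$, $D_2=\{Q_\alpha\}_{\alpha\in A_2}$, subsets $B_i\subseteq A_i$ with $|B_1|=|B_2|$ and a bijection $\varphi:B_1\to B_2$, let $$J(\varphi):=\max\Big(\max_{\beta\in B_1}\|P_\beta-Q_{\varphi(\beta)}\|_\infty,\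 \max_{\alpha\in A_1\setminus B_1}\tfrac12\mathrm{pers}(P_\alpha),\ \max_{\alpha\in A_2\setminus B_2}\tfrac12\mathrm{pers}(Q_\alpha)\Big),$$ and $d_{\mathcal{D}}(D_1,D_2):=\min_{(B_1,B_2,\varphi)}J(\varphi)$ over all such triples. *)

(* Defs.v *)
From HB Require Import structures.
From mathcomp Require Import boolp classical_sets reals constructive_ereal ereal.
From mathcomp Require Import all_boot all_order all_algebra.

Set Implicit Arguments.
Unset Strict Implicit.
Unset Printing Implicit Defensive.

Import Order.TTheory GRing.Theory Num.Theory.

Local Open Scope ring_scope.

(* Only the values of [filtration] on nonempty sets are meaningful; every
   definition below ignores its value at the empty set. *)
Record filtered_space (R : realType) := FilteredSpace {
  points :> finType;
  points_gt0 : (0 < #|points|)%N;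
  filtration : {set points} -> R;
  filtration_mono : forall s t : {set points},
    t != finset.set0 -> t \subset s -> filtration t <= filtration s }.

Definition surjective (A B : Type) (f : A -> B) := forall b, exists a, f a = b.

(* The index 0 of the maximum is harmless: the terms are nonnegative, and [Z]
   is nonempty as soon as it surjects onto a filtered space. *)
Definition distortion (R : realType) (X Y : filtered_space R) (Z : finType)
    (phiX : Z -> X) (phiY : Z -> Y) : R :=
  \big[Num.max/0]_(t : {set Z} | t != finset.set0)
    `|filtration (phiX @: t) - filtration (phiY @: t)|.

Definition filtered_dist (R : realType) (X Y : filtered_space R) : R :=
  inf [set r : R | exists (Z : finType) (phiX : Z -> X) (phiY : Z -> Y),
    [/\ surjective phiX, surjective phiY & r = distortion phiX phiY]]%classic.

(* The quotient of [U] by a subspace [V] of [U], modelled on the complement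
   [U :\: V] of [V] in [U]; [quotv_pi U V] restricts to a surjection from [U]
   with kernel [V], see [quotv_pi_eq0] and [quotv_piK]. *)
Section Quotient.
Variables (F : fieldType) (vT : vectType F).
Implicit Types U V : {vspace vT}.

Definition quotv U V : vectType F := subvs_of (U :\: V)%VS.

Definition quotv_pi U V : 'Hom(vT, quotv U V) :=
  (linfun (vsproj (U :\: V)%VS) \o addv_pi1 U V)%VF.

(* The map induced by the identity of [vT] when U <= U' and V <= V'. *)
Definition quotv_map U V U' V' : 'Hom(quotv U V, quotv U' V') :=
  (quotv_pi U' V' \o linfun (@vsval F vT (U :\: V)%VS))%VF.

Lemma val_quotv_pi U V v : vsval (quotv_pi U V v) = addv_pi1 U V v.
Proof. by rewrite comp_lfunE lfunE /= vsprojK // memv_pi. Qed.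

Lemma quotv_pi_eq0 U V v : v \in U -> (quotv_pi U V v == 0) = (v \in V).
Proof.
move=> vU.
have -> : (quotv_pi U V v == 0) = (addv_pi1 U V v == 0).
  by rewrite -val_quotv_pi; apply/eqP/eqP => [-> //|v0]; apply: val_inj.
have vUV : v \in (U + V)%VS by rewrite (subvP (addvSl U V)).
have dv := addv_pi1_pi2 vUV.
apply/eqP/idP => [v0 | vV]; first by rewrite -dv v0 add0r memv_pi2.
by move: dv; rewrite addv_pi2_id // -[RHS]add0r => /addIr.
Qed.

Lemma quotv_piK U V (u : quotv U V) : quotv_pi U V (vsval u) = u.
Proof.
apply: subvs_inj; apply: etrans (val_quotv_pi U V _) _.
by rewrite /addv_pi1 daddv_pi_id ?capv_diff // subvsP.
Qed.

Lemma quotv_mapE U V U' V' v : (U <= U')%VS -> (V <= V')%VS -> v \in U ->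
  quotv_map U V U' V' (quotv_pi U V v) = quotv_pi U' V' v.
Proof.
move=> sU sV vU; apply: etrans (comp_lfunE _ _ _) _.
have -> : linfun (@vsval F vT (U :\: V)%VS) (quotv_pi U V v) = addv_pi1 U V v.
  by apply: etrans (lfunE _ _) _; apply: val_quotv_pi.
have vUV : v \in (U + V)%VS by rewrite (subvP (addvSl U V)).
rewrite -[in RHS](addv_pi1_pi2 vUV) linearD /=.
have p2V := memv_pi2 U V v; have p1U := memv_pi1 U V v.
suff /eqP-> : quotv_pi U' V' (addv_pi2 U V v) == 0 by rewrite addr0.
rewrite quotv_pi_eq0 ?(subvP sV) //.
apply: (subvP sU).
by rewrite -[addv_pi2 U V v](addKr (addv_pi1 U V v)) addv_pi1_pi2 // addrC rpredB.
Qed.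

End Quotient.

Record pvect (F : fieldType) (R : realType) := PVect {
  pobj : R -> vectType F;
  pmap : forall s t : R, s <= t -> 'Hom(pobj s, pobj t);
  pmap_id : forall (t : R) (tt : t <= t) x, pmap tt x = x;
  pmap_comp : forall (s t u : R) (st : s <= t) (tu : t <= u) (su : s <= u) x,
    pmap tu (pmap st x) = pmap su x }.

Definition pvect_iso (F : fieldType) (R : realType) (V W : pvect F R) : Prop :=
  exists f : forall t, 'Hom(pobj V t, pobj W t),
    (forall t, bijective (f t)) /\
    (forall s t (st : s <= t) x, f t (pmap V st x) = pmap W st (f s x)).

Section Interval.
Variables (F : fieldType) (R : realType).

Definition in_interval (I : R * \bar R) (t : R) : bool :=
  (I.1 <= t) && (t%:E < I.2)%E.

(* The boolean [in_interval I t] is used as a dimension: the space at [t] is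
   ['rV_1] on the interval and ['rV_0] off it, and multiplication by the
   all-ones matrix is the identity of ['rV_1] or the zero map. *)
Definition interval_map (I : R * \bar R) (s t : R) :
    'Hom('rV[F]_(in_interval I s), 'rV[F]_(in_interval I t)) :=
  linfun (mulmxr (const_mx 1)).

Lemma interval_map_id I t (tt : t <= t) x : interval_map I t t x = x.
Proof.
rewrite lfunE /=; case: (in_interval I t) x => x; last by rewrite [x]thinmx0 mul0mx.
by apply/rowP=> i; rewrite mxE big_ord1 mxE mulr1 !ord1.
Qed.

Lemma interval_map_comp I s t u (st : s <= t) (tu : t <= u) (su : s <= u) x :
  interval_map I t u (interval_map I s t x) = interval_map I s u x.
Proof.
rewrite !lfunE /=.
have: in_interval I s -> in_interval I u -> in_interval I t.
  rewrite /in_interval => /andP[bs _] /andP[_ ud].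
  by rewrite (le_trans bs st) (le_lt_trans _ ud) // lee_fin.
case: (in_interval I s) x => x; last by rewrite [x]thinmx0 !mul0mx.
case: (in_interval I u) => H; last by apply/rowP => [[]].
rewrite H //; apply/rowP=> i; rewrite !mxE !big_ord1 !mxE !big_ord1 !mxE.
by rewrite !mulr1.
Qed.

Definition interval_pvect (I : R * \bar R) : pvect F R :=
  PVect (@interval_map_id I) (@interval_map_comp I).

Definition pvect_zero : pvect F R :=
  @PVect F R (fun=> 'rV[F]_0) (fun _ _ _ => \1%VF)
    (fun _ _ x => id_lfunE x) (fun _ _ _ _ _ _ x => id_lfunE _).

Section Sum.
Variables V W : pvect F R.

Definition psum_map s t (st : s <= t) :
    'Hom((pobj V s * pobj W s)%type, (pobj V t * pobj W t)%type) :=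
  linfun (fun x => (pmap V st x.1, pmap W st x.2)).

Lemma psum_mapE s t (st : s <= t) x :
  psum_map st x = (pmap V st x.1, pmap W st x.2).
Proof.
pose f (x : (pobj V s * pobj W s)%type) := (pmap V st x.1, pmap W st x.2).
have lf : linear f by move=> a u v; rewrite /f /= !linearP.
pose fL := GRing.isSemilinear.Build _ _ _ _ f (GRing.semilinear_linear lf).
pose f' : {linear _ -> _} := HB.pack f fL.
exact: (lfunE f').
Qed.

Lemma psum_map_id t (tt : t <= t) x : psum_map tt x = x.
Proof. by rewrite psum_mapE !pmap_id -surjective_pairing. Qed.

Lemma psum_map_comp s t u (st : s <= t) (tu : t <= u) (su : s <= u) x :
  psum_map tu (psum_map st x) = psum_map su x.
Proof. by rewrite !psum_mapE /= !(pmap_comp st tu su). Qed.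

Definition pvect_sum : pvect F R := PVect psum_map_id psum_map_comp.

End Sum.

(* A finite multiset of points (b, d) is represented by a list. *)
Definition interval_sum (D : seq (R * \bar R)) : pvect F R :=
  foldr (fun I V => pvect_sum (interval_pvect I) V) pvect_zero D.

Definition is_diagram (V : pvect F R) (D : seq (R * \bar R)) : Prop :=
  (forall I, I \in D -> (I.1%:E < I.2)%E) /\ pvect_iso V (interval_sum D).

End Interval.

Section Homology.
Variables (F : fieldType) (X : finType).
Implicit Types (L : {set {set X}}) (k : nat).

Local Notation chain := {ffun {set X} -> F^o}.

(* The number of vertices of [t] preceding [x], for the enumeration order. *)
Definition vertex_pos (x : X) (t : {set X}) : nat :=
  #|[set y in t | (enum_rank y < enum_rank x)%N]|.

(* The usual d[v_0,...,v_k] = \sum_i (-1)^i [v_0,...,^v_i,...,v_k], vertices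
   being listed in the enumeration order, read off coefficientwise: the faces
   t of codimension one of s are the t with s = x |: t for some x \notin t.
   Homology being unreduced, the coefficient at the empty set is 0. *)
Definition boundary_fun (c : chain) : chain :=
  [ffun t => if t == finset.set0 then 0 else
    \sum_(x | x \notin t) (-1) ^+ vertex_pos x t * c (x |: t)].

Lemma boundary_is_linear : linear boundary_fun.
Proof.
move=> a c c'; apply/ffunP=> t; rewrite !ffunE.
case: ifP => _; first by rewrite scaler0 addr0.
rewrite scaler_sumr -big_split; apply: eq_bigr => x _ /=.
by rewrite !ffunE mulrDr /GRing.scale /= mulrCA.
Qed.

HB.instance Definition _ :=
  GRing.isSemilinear.Build F chain chain _ boundary_fun
    (GRing.semilinear_linear boundary_is_linear).

Definition boundary : 'End(chain) := linfun boundary_fun.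

Definition simplex_chain (s : {set X}) : chain := [ffun t => (t == s)%:R].

Definition chains k L : {vspace chain} :=
  <<[seq simplex_chain s | s : {set X} <- enum L & #|s| == k.+1]>>%VS.

Definition cycles k L : {vspace chain} := (chains k L :&: lker boundary)%VS.

Definition boundaries k L : {vspace chain} := (boundary @: chains k.+1 L)%VS.

Definition homology k L : vectType F := quotv (cycles k L) (boundaries k L).

Definition homology_map k L L' : 'Hom(homology k L, homology k L') :=
  quotv_map (cycles k L) (boundaries k L) (cycles k L') (boundaries k L').

Lemma chains_sub k L L' : L \subset L' -> (chains k L <= chains k L')%VS.
Proof.
move=> sL; apply: sub_span => c /mapP[s]; rewrite mem_filter mem_enum.
move=> /andP[ks sLs] ->; apply: map_f.
by rewrite mem_filter ks mem_enum (subsetP sL).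
Qed.

Lemma cycles_sub k L L' : L \subset L' -> (cycles k L <= cycles k L')%VS.
Proof. by move=> sL; apply: capvS => //; apply: chains_sub. Qed.

Lemma boundaries_sub k L L' :
  L \subset L' -> (boundaries k L <= boundaries k L')%VS.
Proof. by move=> sL; apply: limgS; apply: chains_sub. Qed.

Lemma homology_map_id k L x : homology_map k L L x = x.
Proof.
have xU : vsval x \in cycles k L by rewrite (subvP (diffvSl _ _) _ (subvsP x)).
by rewrite -{1}[x]quotv_piK quotv_mapE // quotv_piK.
Qed.

Lemma homology_map_comp k L L' L'' x : L \subset L' -> L' \subset L'' ->
  homology_map k L' L'' (homology_map k L L' x) = homology_map k L L'' x.
Proof.
move=> s1 s2; have s3 := subset_trans s1 s2.
have xU : vsval x \in cycles k L by rewrite (subvP (diffvSl _ _) _ (subvsP x)).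
rewrite -[x]quotv_piK !quotv_mapE ?cycles_sub ?boundaries_sub //.
exact: (subvP (cycles_sub k s1)).
Qed.

End Homology.

Section PersistentHomology.
Variables (F : fieldType) (R : realType) (X : filtered_space R).

Definition sublevel (e : R) : {set {set X}} :=
  [set s : {set X} | (s != finset.set0) && (filtration s <= e)]%SET.

Lemma sublevel_sub e e' : e <= e' -> sublevel e \subset sublevel e'.
Proof.
move=> ee'; apply/subsetP=> s; rewrite !inE => /andP[-> /=] h.
exact: le_trans h ee'.
Qed.

Definition pers_homology (k : nat) : pvect F R :=
  @PVect F R (fun e => homology F k (sublevel e))
    (fun s t _ => homology_map F k (sublevel s) (sublevel t))
    (fun t _ x => homology_map_id x)
    (fun s t u st tu _ x =>
       homology_map_comp x (sublevel_sub st) (sublevel_sub tu)).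

(* A diagram exists by the structure theorem for persistence vector spaces and
   is unique up to permutation; the default value [::] is never used. *)
Definition pdiagram (k : nat) : seq (R * \bar R) :=
  xget [::] (fun D => is_diagram (pers_homology k) D).

End PersistentHomology.

Section Bottleneck.
Variable R : realType.
Implicit Types (P Q : R * \bar R) (D : seq (R * \bar R)).
Local Open Scope ereal_scope.

Definition pers P : \bar R := P.2 - P.1%:E.

(* The test implements |oo - oo| = 0, since +oo - +oo = -oo in [\bar R]. *)
Definition abs_diff (x y : \bar R) : \bar R :=
  if x == y then 0 else `|x - y|.

Definition point_dist P Q : \bar R :=
  maxe (abs_diff P.1%:E Q.1%:E) (abs_diff P.2 Q.2).

Definition pt D (i : 'I_(size D)) : R * \bar R := tnth (in_tuple D) i.

(* The points of [D] are indexed by ['I_(size D)]. *)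
Definition matching_cost D1 D2
    (B1 : {set 'I_(size D1)}) (B2 : {set 'I_(size D2)})
    (phi : {i | i \in B1} -> {j | j \in B2}) : \bar R :=
  maxe (\big[maxe/0]_(i : {i | i \in B1}) point_dist (pt (val i)) (pt (val (phi i))))
    (maxe (\big[maxe/0]_(i | i \notin B1) ((2^-1)%:E * pers (pt i)))
          (\big[maxe/0]_(j | j \notin B2) ((2^-1)%:E * pers (pt j)))).

(* There are finitely many triples, so the infimum is a minimum. *)
Definition bottleneck D1 D2 : \bar R :=
  ereal_inf [set c : \bar R | exists (B1 : {set 'I_(size D1)})
    (B2 : {set 'I_(size D2)}) (phi : {i | i \in B1} -> {j | j \in B2}),
    bijective phi /\ c = matching_cost phi]%classic.

End Bottleneck.

(* Main.v *)
Require Import Defs.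
From HB Require Import structures.
From mathcomp Require Import boolp classical_sets reals constructive_ereal ereal.
From mathcomp Require Import all_boot all_order all_algebra.
From mathcomp Require Import lra.

(** Stability of persistence diagrams under the distance of filtered spaces.

    It suffices to bound the bottleneck distance by the distortion [e] of every
    parametrization.  Choosing sections of its two surjections, one may assume
    that [X] and [Y] embed in a common vertex set [Z], as monotone sections of
    maps from [Z] to [X] and to [Y], along which the two filtrations pull back to
    filtrations of [Z] at distance at most [e].  In a pulled back complex every
    vertex is dominated by its representative in [X]; sliding vertices one at a
    time onto their representatives is homotopic to the identity, so the pulled
    back complexes compute the homology of [X] ([pullback_equivalence]).  Since
    the sublevel complexes of the two pulled back filtrations are nested up to a
    shift by [e], the persistent homologies of [X] and [Y] are [e]-interleaved
    ([pers_homology_interleaved]).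

    Diagrams exist because homology is a quotient of cycles by boundaries, two
    increasing families of subspaces of one fixed space: a basis adapted to both
    ([common_adapted_basis]) provides the intervals ([quotv_diagram]).

    Finally, interleaved modules with interval decompositions have close diagrams
    ([interleaved_bottleneck]).  In bases, the two morphisms of an interleaving
    become matrices of scalars.  A nonzero scalar forces births and deaths to
    increase by at most [e]; so, comparing bars by the sum of birth and death, a
    bar through which the composite of two nonzero components passes, from a
    long bar to a larger one, is within [e] of one of the two.  The
    matrices restricted to a set of long bars and to the bars within [e] of it
    thus have a unitriangular product, so the latter are at least as many as the
    former ([long_card]): this is Hall's condition.  Matchings on both
    sides are merged in [covering_matching]. *)

Set Implicit Arguments.
Unset Strict Implicit.
Unset Printing Implicit Defensive.

Import Order.TTheory GRing.Theory Num.Theory.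

Local Open Scope ring_scope.

Local Notation pmap := Defs.pmap.
Local Notation bar D i := (nth (0, 0%E) D i).

(** * Bases adapted to two flags *)

Section AdaptedBasis.
Variables (F : fieldType) (vT : vectType F).
Implicit Types (U V W : {vspace vT}) (Us : seq {vspace vT}) (B : seq vT).

(** The reverse inclusion always holds, and when [<<B>>] is everything this says
    that [U] is spanned by the members of [B] that it contains. *)
Definition adapted B U :=
  (U :&: <<B>> <= <<[seq b <- B | b \in U]>>)%VS.

Definition subspace_chain Us :=
  {in Us &, forall U V, (U <= V)%VS || (V <= U)%VS}.

(** If the new vector [x] is taken in the smallest member [U0] of the chain that
    meets the enlarged space outside [<<B>>], then adaptedness survives: a member
    [U] either sees no new vector, or contains [U0], hence [x], and then any
    [y = a *: x + w] in [U] has its [w] in [U] as well. *)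
Lemma adapted_extend1 Us B e : subspace_chain Us -> free B ->
  {in Us, forall U, adapted B U} -> e \notin <<B>>%VS ->
  exists x, [/\ free (x :: B), <<x :: B>>%VS = <<e :: B>>%VS &
    {in Us, forall U, adapted (x :: B) U}].
Proof.
move=> chU frB adB eB.
set W' := <<e :: B>>%VS.
have BW' : (<<B>> <= W')%VS by rewrite /W' span_cons addvSr.
pose bad U := ~~ (U :&: W' <= <<B>>)%VS.
have [x xW' [xB xmin]] : exists2 x, x \in W' & x \notin <<B>>%VS /\
    {in Us, forall U, bad U -> x \in U}.
  elim: (Us) chU => [_|U s IH chs].
    by exists e; [rewrite /W' memv_span ?mem_head|split].
  have [|x xW' [xB xmin]] := IH.
    by move=> U1 V1 U1s V1s; apply: chs; rewrite inE (U1s, V1s) orbT.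
  have [badU|goodU] := boolP (bad U); last first.
    exists x => //; split=> // U1; rewrite inE => /predU1P[->|/xmin//].
    by rewrite (negPf goodU).
  have [xU|xU] := boolP (x \in U).
    exists x => //; split=> // U1; rewrite inE => /predU1P[->//|/xmin//].
  have /subvPn[y /[!memv_cap]/andP[yU yW'] yB] := badU.
  exists y => //; split=> // U1; rewrite inE => /predU1P[->//|U1s] bU1.
  have /orP[UU1|U1U] : (U <= U1)%VS || (U1 <= U)%VS.
  - by apply: chs; rewrite inE ?eqxx ?U1s ?orbT.
  - exact: subvP UU1 _ yU.
  - by rewrite (subvP U1U) // xmin in xU.
have frx : free (x :: B) by rewrite free_cons xB.
have fre : free (e :: B) by rewrite free_cons eB.
have spx : <<x :: B>>%VS = W'.
  apply/eqP; rewrite eqEdim /W'; apply/andP; split.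
    by rewrite span_cons subv_add BW' andbT -memvE.
  by move/eqP: frx => ->; move/eqP: fre => ->.
exists x; split=> // U UUs; rewrite /adapted spx.
apply/subvP=> y /[!memv_cap]/andP[yU yW'].
have [yB|yB] := boolP (y \in <<B>>%VS).
  have /subvP sub := adB U UUs; have := sub y; rewrite memv_cap yU yB => /(_ isT).
  apply/subvP/sub_span => z; rewrite !mem_filter => /andP[-> zB].
  by rewrite inE zB orbT.
have xU : x \in U.
  apply: xmin => //; apply/subvPn; exists y => //; by rewrite memv_cap yU.
move: yW'; rewrite -spx span_cons => /memv_addP[_ /vlineP[a ->] [w wB yE]].
have wU : w \in U by rewrite -[w](addKr (a *: x)) -yE addrC rpredB // rpredZ.
rewrite /= xU span_cons yE memv_add ?memvZ ?memv_line //.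
by apply: (subvP (adB U UUs)); rewrite memv_cap wU.
Qed.

Lemma adapted_extend Us B V : subspace_chain Us -> free B ->
  {in Us, forall U, adapted B U} -> (<<B>> <= V)%VS ->
  exists B', [/\ free (B' ++ B), <<B' ++ B>>%VS = V &
    {in Us, forall U, adapted (B' ++ B) U}].
Proof.
move=> chU; have [n] := ubnP (\dim V - \dim <<B>>)%N.
elim: n B => // n IH B ltn frB adB sBV.
have [VB|/subvPn[e eV eB]] := boolP (V <= <<B>>)%VS.
  by exists [::]; split=> //; apply/eqP; rewrite eqEsubv sBV.
have [x [frx spx adx]] := adapted_extend1 chU frB adB eB.
have xV : (<<x :: B>> <= V)%VS by rewrite spx span_cons subv_add -memvE eV.
have dx : \dim <<x :: B>> = (\dim <<B>>).+1.
  by move/eqP: frx => ->; move/eqP: frB => ->.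
have [|B' [frB' spB' adB']] := IH (x :: B) _ frx adx xV.
  rewrite dx -(ltn_add2r 1) addn1.
  have := dimvS xV; rewrite dx => dV.
  by rewrite addn1 (leq_trans _ ltn) // ltnS subnS prednK // subn_gt0.
by exists (rcons B' x); rewrite cat_rcons.
Qed.

Lemma span_filter_sub B U : (<<[seq b <- B | b \in U]>> <= U)%VS.
Proof. by apply/span_subvP => b; rewrite mem_filter => /andP[]. Qed.

Lemma adapted_suffix B B' : adapted (B' ++ B) <<B>>%VS.
Proof.
apply/subvP=> y /[!memv_cap]/andP[yB _].
move: y yB; apply/subvP/sub_span => z zB.
by rewrite mem_filter memv_span // mem_cat zB orbT.
Qed.

(** Linear algebra behind the structure theorem: two flags of a vector space have
    a common adapted basis (Bruhat decomposition).  The basis is built along the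
    flag [Vs], so that every [V] is spanned by a suffix of it, each step being
    made adapted to [Us] by [adapted_extend]. *)
Lemma common_adapted_basis Us Vs : subspace_chain Us -> subspace_chain Vs ->
  exists B, [/\ free B, <<B>>%VS = fullv &
    {in Us ++ Vs, forall U, U = <<[seq b <- B | b \in U]>>%VS}].
Proof.
move=> chU chV.
pose leV U V := (U <= V)%VS.
suff H : forall s, sorted leV s -> exists B,
    [/\ free B, <<B>>%VS = last 0%VS s, {in Us, forall U, adapted B U} &
        {in s, forall V, adapted B V /\ (V <= last 0%VS s)%VS}].
  (* the full space is appended so that the basis ends up spanning it *)
  pose s := sort (fun U V : {vspace vT} => (\dim U <= \dim V)%N) Vs.
  have s_sorted : sorted leV (rcons s fullv).
    have : sorted leV s.
      have: sorted (fun U V : {vspace vT} => (\dim U <= \dim V)%N) s.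
        by apply: sort_sorted => U V; apply: leq_total.
      apply: (@sub_in_sorted _ (mem s)); last exact/allP.
      move=> U V; rewrite !mem_sort => UVs VVs dUV.
      have /orP[//|VU] := chV _ _ UVs VVs.
      by rewrite /leV; suff -> : U = V by []; apply/esym/eqP; rewrite eqEdim VU.
    case: (s) => //= U s1 ps; rewrite rcons_path ps /leV subvf //.
  have [B [frB spB adU adV]] := H _ s_sorted.
  rewrite last_rcons in spB; exists B; split=> // U; rewrite mem_cat => UUV.
  have : adapted B U.
    case/orP: UUV => [/adU//|UVs].
    by have [] := adV U _; rewrite // mem_rcons inE mem_sort UVs orbT.
  rewrite /adapted spB capvf => sU; apply/eqP.
  by rewrite eqEsubv sU span_filter_sub.
elim/last_ind => [_|s V IH sV].
  exists [::]; rewrite nil_free span_nil; split=> // U _.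
  by rewrite /adapted span_nil capv0 sub0v.
have [sS sl] : sorted leV s /\ (last 0%VS s <= V)%VS.
  case: (s) sV => [_|U s1] /=; first by rewrite sub0v.
  by rewrite rcons_path => /andP[].
have [B [frB spB adU adV]] := IH sS.
have [|B' [frB' spB' adB']] := adapted_extend (V := V) chU frB adU.
  by rewrite spB.
exists (B' ++ B); rewrite last_rcons; split=> // V1.
rewrite mem_rcons inE => /predU1P[->|V1s].
  by split=> //; rewrite -{1}spB'; apply: (@adapted_suffix _ [::]).
have [adV1 V1l] := adV _ V1s; split; last exact: subv_trans sl.
apply/subvP=> y /[!memv_cap]/andP[yV1 _].
have /subvP/(_ y) := adV1; rewrite memv_cap yV1 spB (subvP V1l) // => /(_ isT).
apply/subvP/sub_span => z; rewrite !mem_filter mem_cat => /andP[-> ->].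
by rewrite orbT.
Qed.

End AdaptedBasis.

(** * Interval decompositions in coordinates *)

Section IntervalBasis.
Variables (F : fieldType) (R : realType).
Implicit Types (V W : pvect F R) (D : seq (R * \bar R)).

Definition alive D i t := in_interval (bar D i) t.

(** An isomorphism with the interval sum of [D], in coordinates.  The generator of
    a bar vanishes outside the bar (see [gen_dead]); [pmap_gen] therefore says
    that it stays constant along the bar and is sent to 0 at its death. *)
Record interval_basis V D := IntervalBasis {
  gen : nat -> forall t, pobj V t;
  coef : nat -> forall t, pobj V t -> F;
  coef_linear : forall i t, linear (@coef i t : pobj V t -> F^o);
  gen_coef : forall t x, x = \sum_(i < size D) coef i x *: gen i t;
  coef_gen : forall i j t, (i < size D)%N -> (j < size D)%N ->
    coef i (gen j t) = ((i == j) && alive D i t)%:R;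
  pmap_gen : forall i s t (st : s <= t), (i < size D)%N ->
    (bar D i).1 <= s -> pmap V st (gen i s) = gen i t }.

Lemma coef_lincomb V D (b : interval_basis V D) i t (J : finType) (a : J -> F)
    (x : J -> pobj V t) :
  coef b i (\sum_j a j *: x j) = \sum_j a j * coef b i (x j).
Proof.
pose fL := GRing.isSemilinear.Build F _ _ _ (coef b i (t := t) : _ -> F^o)
   (GRing.semilinear_linear (coef_linear b i (t := t))).
pose f : {linear pobj V t -> F^o} := HB.pack (coef b i (t := t) : _ -> F^o) fL.
rewrite -[LHS]/(f _) linear_sum; apply: eq_bigr => j _.
by rewrite linearZ.
Qed.

Lemma coef_at0 V D (b : interval_basis V D) i t : coef b i (0 : pobj V t) = 0.
Proof.
have := @coef_lincomb _ _ b i t 'I_0 (fun=> 0) (fun=> 0).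
by rewrite !big_ord0.
Qed.

Lemma gen_dead V D (b : interval_basis V D) i t :
  (i < size D)%N -> ~~ alive D i t -> gen b i t = 0.
Proof.
move=> iD /negPf dead; rewrite (gen_coef b (gen b i t)) big1 // => j _.
by rewrite coef_gen //; case: eqP => [->|_]; rewrite ?dead scale0r.
Qed.

Lemma coef_dead V D (b : interval_basis V D) i t (x : pobj V t) :
  (i < size D)%N -> ~~ alive D i t -> coef b i x = 0.
Proof.
move=> iD /negPf dead; rewrite (gen_coef b x) coef_lincomb big1 // => j _.
by rewrite coef_gen // dead andbF mulr0.
Qed.

Lemma interval_basis_inj V D (b : interval_basis V D) t (x y : pobj V t) :
  (forall i, (i < size D)%N -> coef b i x = coef b i y) -> x = y.
Proof.
move=> xy; rewrite (gen_coef b x) (gen_coef b y).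
by apply: eq_bigr => i _; rewrite xy.
Qed.

Lemma interval_basis_iso V W D :
  interval_basis V D -> interval_basis W D -> pvect_iso V W.
Proof.
move=> b b'.
pose h V W (b : interval_basis V D) (b' : interval_basis W D) t
    (x : pobj V t) : pobj W t :=
  \sum_(i < size D) coef b i x *: gen b' i t.
have coef_h V1 W1 (b1 : interval_basis V1 D) (b2 : interval_basis W1 D) i t x :
    (i < size D)%N -> coef b2 i (@h V1 W1 b1 b2 t x) = coef b1 i x.
  move=> iD; rewrite coef_lincomb [in RHS](gen_coef b1 x) coef_lincomb.
  by apply: eq_bigr => j _; rewrite !coef_gen.
have lin_h V1 W1 (b1 : interval_basis V1 D) (b2 : interval_basis W1 D) t :
    linear (@h V1 W1 b1 b2 t).
  move=> a u v; rewrite /h scaler_sumr -big_split; apply: eq_bigr => i _ /=.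
  by rewrite coef_linear scalerDl scalerA.
pose hL t : {linear pobj V t -> pobj W t} := HB.pack (@h V W b b' t)
   (GRing.isSemilinear.Build F _ _ _ _
   (GRing.semilinear_linear (lin_h V W b b' t))).
have hLE t x : linfun (hL t) x = @h V W b b' t x by rewrite lfunE.
exists (fun t => linfun (hL t)); split=> [t|s t st x].
  exists (@h W V b' b t) => x; rewrite hLE.
    by apply: (interval_basis_inj (b := b)) => i iD; rewrite !coef_h.
  by apply: (interval_basis_inj (b := b')) => i iD; rewrite !coef_h.
rewrite (gen_coef b x) !linear_sum /=; apply: eq_bigr => i _.
rewrite !linearZ /= !hLE; congr (_ *: _).
have [dead|] := boolP (alive D i s); last first.
  by move=> dead; rewrite (gen_dead b) // -!hLE !linear0.
have [bi _] := andP dead.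
have hgen u : @h V W b b' u (gen b i u) = gen b' i u.
  by apply: (interval_basis_inj (b := b')) => j jD; rewrite coef_h // !coef_gen.
by rewrite pmap_gen // !hgen pmap_gen.
Qed.

Lemma interval_basis_transport V W D
  (f : forall t, 'Hom(pobj W t, pobj V t)) (g : forall t, pobj V t -> pobj W t)
  (fK : forall t, cancel (f t) (g t)) (gK : forall t, cancel (g t) (f t))
  (fnat : forall s t (st : s <= t) x, f t (pmap W st x) = pmap V st (f s x)) :
  interval_basis V D -> interval_basis W D.
Proof.
move=> b.
pose e i t := g t (gen b i t).
pose c i t x := coef b i (f t x).
apply: (@IntervalBasis W D e c).
- by move=> i t a u v; rewrite /c linearP coef_linear.
- move=> t x; apply: (can_inj (fK t)); rewrite linear_sum [LHS](gen_coef b).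
  by apply: eq_bigr => i _; rewrite linearZ /= /e gK.
- by move=> i j t iD jD; rewrite /c /e gK coef_gen.
- move=> i s t st iD bi; apply: (can_inj (fK t)).
  by rewrite fnat /e !gK pmap_gen.
Qed.

Lemma rV_bool_const (c : bool) (x : 'rV[F]_c) :
  x = (\sum_j x 0 j) *: const_mx 1.
Proof.
case: c x => x; last by apply/rowP => [[]].
by apply/rowP=> i; rewrite !mxE big_ord1 mulr1 !ord1.
Qed.

Lemma interval_sum_basis D : interval_basis (interval_sum F D) D.
Proof.
elim: D => [|I D b].
  apply: (@IntervalBasis (interval_sum F [::]) [::]
    (fun _ _ => 0) (fun _ _ _ => 0)) => //.
  - by move=> i t a u v; rewrite scaler0 addr0.
  - by move=> t x; rewrite big_ord0; apply/rowP => [[]].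
pose V := interval_sum F (I :: D).
pose e i t : pobj V t := if i is i'.+1 then (0, gen b i' t) else (const_mx 1, 0).
pose c i t (x : pobj V t) : F :=
  if i is i'.+1 then coef b i' x.2 else \sum_j x.1 0 j.
apply: (@IntervalBasis V (I :: D) e c).
- case=> [|i] t a u v /=; last by rewrite coef_linear.
  rewrite scaler_sumr -big_split; apply: eq_bigr => j _ /=.
  by rewrite !mxE.
- move=> t [x y]; rewrite big_ord_recl /=.
  have -> : \sum_(i < size D) c (lift ord0 i) t (x, y) *: e (lift ord0 i) t =
      (0, y).
    rewrite [in RHS](gen_coef b y) /=.
    transitivity (\sum_(i < size D) ((0, coef b i y *: gen b i t) : pobj V t)).
      apply: eq_bigr => i _; rewrite /=.
      by congr pair; rewrite /= scaler0.
    by elim/big_rec2: _ => // i y1 y2 _ ->; congr pair; apply: addr0.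
  rewrite /=; congr pair; last by rewrite /= scaler0 add0r.
  rewrite addr0; exact: rV_bool_const.
- case=> [|i] [|j] t iD jD /=.
  + rewrite /alive /=; case: (in_interval I t); rewrite ?big_ord0 //.
    by rewrite big_ord1 mxE.
  + by rewrite big1 // => k _; rewrite mxE.
  + exact: coef_at0.
  + by rewrite coef_gen.
- case=> [|i] s t st iD bi; apply: (etrans (psum_mapE _ _)) => /=.
    congr pair; last by rewrite linear0.
    rewrite lfunE /=; apply/rowP=> j; rewrite !mxE.
    have : in_interval I s.
      have /andP[_ td] : in_interval I t by case: (in_interval I t) j => // [[]].
      by rewrite /in_interval bi (le_lt_trans _ td).
    by case: (in_interval I s) => //= _; rewrite big_ord1 !mxE mulr1.
  by congr pair; rewrite ?linear0 ?pmap_gen.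
Qed.

Lemma is_diagram_basis V D : is_diagram V D -> interval_basis V D.
Proof.
move=> [_ /cid[f [fb fnat]]].
have inv t : {g : pobj (interval_sum F D) t -> pobj V t |
    cancel (f t) g /\ cancel g (f t)}.
  by apply: cid; have [g] := fb t; exists g.
pose g t := sval (inv t).
have fK t : cancel (f t) (g t) by have [] := svalP (inv t).
have gK t : cancel (g t) (f t) by have [] := svalP (inv t).
exact: interval_basis_transport fK gK fnat (interval_sum_basis D).
Qed.

Lemma basis_is_diagram V D : (forall I, I \in D -> (I.1%:E < I.2)%E) ->
  interval_basis V D -> is_diagram V D.
Proof.
by move=> pD b; split=> //; apply: interval_basis_iso b (interval_sum_basis D).
Qed.

End IntervalBasis.

(** * Matchings *)

Section Hall.
Variables (I J : finType) (r : I -> J -> bool).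
Implicit Types (A B S : {set I}) (T : {set J}).

Definition neighbours A : {set J} := [set j | [exists i in A, r i j]].

Lemma neighboursU A B : neighbours (A :|: B) = neighbours A :|: neighbours B.
Proof.
apply/setP=> j; rewrite !inE; apply/exists_inP/orP.
  by case=> i /[!inE] /orP[] iA rij; [left|right]; apply/exists_inP; exists i.
by case=> /exists_inP[i iA rij]; exists i; rewrite // inE iA ?orbT.
Qed.

(** Halmos and Vaughan's induction: if some proper nonempty [A] has exactly
    [#|A|] neighbours, match [A] and its complement separately; otherwise there
    is slack, and any one edge may be put in the matching. *)
Lemma hall_relative (f0 : I -> J) S T :
  (forall A, A \subset S -> (#|A| <= #|neighbours A :&: T|)%N) ->
  exists f : I -> J,
    {in S &, injective f} /\ {in S, forall i, r i (f i) && (f i \in T)}.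
Proof.
have [n] := ubnP #|S|; elim: n S T => // n IH S T ltn hall.
have [->|[i0 i0S]] := set_0Vmem S.
  by exists f0; split=> i; rewrite inE.
have [[A /and3P[AS A0 tight]]|slack] := altP (@existsP _ (fun A =>
    [&& A \proper S, A != finset.set0 & #|neighbours A :&: T| == #|A|])).
  have sAS := proper_sub AS.
  have [||f1 [inj1 r1]] := IH A T.
  - by rewrite (leq_trans (proper_card AS)).
  - by move=> B BA; apply: hall; apply: subset_trans sAS.
  have [||f2 [inj2 r2]] := IH (S :\: A) (T :\: neighbours A).
  - rewrite cardsD (setIidPr sAS) -ltnS (leq_trans _ ltn) // ltnS.
    rewrite -subSn ?subset_leq_card // leq_subLR -addn1 addnC leq_add2r.
    by rewrite card_gt0.
  - move=> B BSA.
    have dAB : [disjoint A & B].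
      rewrite disjoint_sym; apply: disjointWl BSA _.
      rewrite -setI_eq0; apply/eqP/setP => x; rewrite !inE.
      by case: (x \in A); rewrite ?andbF.
    have := hall (A :|: B); rewrite subUset sAS (subset_trans BSA (subsetDl _ _)).
    move=> /(_ isT); rewrite cardsU (disjoint_setI0 dAB) cards0 subn0 neighboursU.
    have -> : (neighbours A :|: neighbours B) :&: T =
        (neighbours A :&: T) :|: (neighbours B :&: (T :\: neighbours A)).
      apply/setP=> j; rewrite !inE.
      by case: [exists i in A, _]; case: (j \in T); rewrite /= ?andbF ?andbT ?orbF.
    move=> h; move: (leq_trans h (leq_card_setU _ _)).
    by rewrite (eqP tight) leq_add2l.
  exists (fun i => if i \in A then f1 i else f2 i); split.
    move=> i i' iS i'S.
    have r2' k : k \in S -> k \notin A -> f2 k \notin neighbours A.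
      move=> kS kA; have kSA : k \in S :\: A by rewrite inE kA.
      by have /andP[_] := r2 k kSA; rewrite inE => /andP[].
    have r1' k : k \in A -> f1 k \in neighbours A.
      move=> kA; have /andP[rk _] := r1 k kA; rewrite inE.
      by apply/exists_inP; exists k.
    case: ifPn => iA; case: ifPn => i'A eqf.
    - exact: inj1.
    - by have := r2' _ i'S i'A; rewrite -eqf r1'.
    - by have := r2' _ iS iA; rewrite eqf r1'.
    - by apply: inj2; rewrite // inE ?iA ?i'A.
  move=> i iS; case: ifPn => iA; first exact: r1.
  have iSA : i \in S :\: A by rewrite inE iA.
  by have /andP[-> /=] := r2 i iSA; rewrite inE => /andP[].
have : (#|[set i0]| <= #|neighbours [set i0] :&: T|)%N.
  by apply: hall; rewrite sub1set.
rewrite cards1 card_gt0 => /set0Pn[j0]; rewrite 2!inE.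
case/andP=> /exists_inP[i /set1P-> rij] j0T.
have [||f [injf rf]] := IH (S :\ i0) (T :\ j0).
- by move: ltn; rewrite (cardsD1 i0) i0S.
- move=> B BS; have [->|B0] := eqVneq B finset.set0; first by rewrite cards0.
  have BS' : B \proper S by apply: sub_proper_trans BS _; apply: properD1.
  have BsS := proper_sub BS'.
  have := slack; rewrite negb_exists => /forallP/(_ B).
  rewrite BS' B0 /= => neB; have := hall B BsS.
  rewrite leq_eqVlt eq_sym (negPf neB) /= => ltB.
  rewrite setIDA -ltnS (leq_trans ltB) // (cardsD1 j0 (neighbours B :&: T)).
  by rewrite -add1n leq_add2r leq_b1.
exists (fun i => if i == i0 then j0 else f i); split.
  move=> i1 i2 i1S i2S; have rf' k : k \in S -> k != i0 -> f k != j0.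
    move=> kS ki; have kSi : k \in S :\ i0 by rewrite !inE ki.
    by have /andP[_] := rf k kSi; rewrite !inE => /andP[].
  case: eqP => [->|/eqP ne1]; case: eqP => [->|/eqP ne2] //.
  - by move=> eqf; have := rf' _ i2S ne2; rewrite -eqf eqxx.
  - by move=> eqf; have := rf' _ i1S ne1; rewrite eqf eqxx.
  - by apply: injf; rewrite !inE ?ne1 ?ne2.
move=> i1 i1S; case: eqP => [->|/eqP ne]; first by rewrite rij.
have i1Si : i1 \in S :\ i0 by rewrite !inE ne.
by have /andP[-> /=] := rf i1 i1Si; rewrite inE => /andP[].
Qed.

Lemma hall : (forall A, (#|A| <= #|neighbours A|)%N) ->
  exists2 f : I -> J, injective f & forall i, r i (f i).
Proof.
move=> hallr.
have [f0 _] : exists f0 : I -> J, forall i, r i (f0 i).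
  apply: (fin_all_exists (P := fun i j => r i j)) => i.
  have := hallr [set i].
  rewrite cards1 card_gt0 => /set0Pn[j]; rewrite inE.
  by case/exists_inP=> _ /set1P-> rij; exists j.
have [A _|f [injf rf]] := @hall_relative f0 [set: I] [set: J].
  by rewrite setIT.
exists f => [i i'|i]; first by apply: injf; rewrite inE.
by have /andP[] := rf i (in_setT i).
Qed.

End Hall.

Section Triangular.
Variables (F : fieldType) (I J : finType) (le : rel I).
Hypotheses (le_refl : reflexive le) (le_trans : transitive le).
Hypothesis le_total : total le.

(** The product of the two matrices is triangular with respect to [le], with 1 on
    the diagonal, so the first one has independent rows: in a vanishing
    combination of rows, the coefficient of a [le]-maximal index is 0. *)
Lemma card_le_of_triangular (A : {set I}) (N : {set J})
    (phi : I -> J -> F) (gamma : J -> I -> F) :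
  (forall i i', i \in A -> i' \in A -> le i i' ->
     \sum_(j in N) phi i j * gamma j i' = (i == i')%:R) ->
  (#|A| <= #|N|)%N.
Proof.
move=> tri.
pose P := \matrix_(a < #|A|, j < #|N|) phi (enum_val a) (enum_val j).
suff /eqP <- : row_free P by apply: rank_leq_col.
apply: inj_row_free => v vP; apply/eqP/negP => /negP v0.
have [a0 va0] : exists a, v 0 a != 0.
  apply/existsP; apply: contraNT v0; rewrite negb_exists => /forallP v0.
  by apply/eqP/rowP => a; rewrite mxE; apply/eqP; rewrite -[_ == _]negbK v0.
pose leA : rel 'I_#|A| := fun a a' => le (enum_val a') (enum_val a).
have [a va amax] : exists2 a, v 0 a != 0 &
    forall a', v 0 a' != 0 -> le (enum_val a') (enum_val a).
  have [||||a /= va amax] := @extremumP _ _ leA a0 (fun a => v 0 a != 0) id.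
  - by move=> x; apply: le_refl.
  - by move=> y x z xy yz; apply: le_trans yz xy.
  - by move=> x y; apply: le_total.
  - by [].
  by exists a.
have : \sum_(j < #|N|) (v *m P) 0 j * gamma (enum_val j) (enum_val a) = v 0 a.
  transitivity (\sum_(b < #|A|) v 0 b *
     \sum_(j < #|N|) phi (enum_val b) (enum_val j) *
       gamma (enum_val j) (enum_val a)).
    under eq_bigr => j _ do rewrite mxE mulr_suml.
    rewrite exchange_big; apply: eq_bigr => b _; rewrite mulr_sumr.
    by apply: eq_bigr => j _; rewrite mxE mulrA.
  have tri' b : v 0 b != 0 ->
      \sum_(j < #|N|) phi (enum_val b) (enum_val j) *
        gamma (enum_val j) (enum_val a) = (b == a)%:R.
    move=> vb; rewrite -(inj_eq enum_val_inj) -tri ?enum_valP ?amax //.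
    by rewrite [RHS]big_enum_val.
  rewrite (bigD1 a) //= tri' // eqxx mulr1 big1 ?addr0 // => b ba.
  have [->|vb] := eqVneq (v 0 b) 0; first by rewrite mul0r.
  by rewrite tri' // (negPf ba) mulr0.
by rewrite vP big1 => [va'|j _]; [rewrite -va' eqxx in va|rewrite mxE mul0r].
Qed.

End Triangular.

Section CoveringMatching.
Variables (m n : nat) (near : 'I_m -> 'I_n -> bool)
  (lm : pred 'I_m) (ln : pred 'I_n).

(** Hall conditions on the two sides give one partial matching that covers both
    all of [lm] and all of [ln] (a theorem of Mendelsohn and Dulmage).  It is
    read off a perfect matching of a padded graph, whose left side has an extra
    dummy for each [j], its right side an extra dummy for each [i]: a point
    outside [lm] or [ln] may be matched to its own dummy, and a left dummy to any
    right dummy. *)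
Lemma covering_matching :
  (forall A : {set 'I_m}, {in A, forall i, lm i} ->
     (#|A| <= #|[set j | [exists i in A, near i j]]|)%N) ->
  (forall B : {set 'I_n}, {in B, forall j, ln j} ->
     (#|B| <= #|[set i | [exists j in B, near i j]]|)%N) ->
  exists (B1 : {set 'I_m}) (B2 : {set 'I_n})
    (phi : {i | i \in B1} -> {j | j \in B2}),
  [/\ bijective phi, forall i, near (val i) (val (phi i)),
     forall i, i \notin B1 -> ~~ lm i & forall j, j \notin B2 -> ~~ ln j].
Proof.
move=> hallm halln.
(* on the left [inr j] is the dummy of [j], on the right [inl i] that of [i] *)
pose T := ('I_m + 'I_n)%type.
pose r (x y : T) : bool := match x, y with
  | inl i, inr j => near i j
  | inl i, inl i' => (i == i') && ~~ lm i
  | inr j, inr j' => (j == j') && ~~ ln j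
  | inr j, inl i => true
  end.
have [S|f injf rf] := @hall T T r.
  pose A := inl @^-1: S : {set 'I_m}; pose B := inr @^-1: S : {set 'I_n}.
  have cardT (U : {set T}) : #|U| = (#|inl @^-1: U| + #|inr @^-1: U|)%N.
    rewrite -!sum1_card big_sumType /=.
    by congr addn; apply: eq_bigl => x; rewrite inE.
  rewrite !cardT -/A -/B.
  pose NA : {set 'I_n} := [set j | [exists i in A, near i j]].
  pose As := [set i in A | lm i]; pose Bs := [set j in B | ln j].
  pose NAs : {set 'I_n} := [set j | [exists i in As, near i j]].
  have Nr : inr @^-1: neighbours r S = NA :|: (B :\: Bs).
    apply/setP => j; rewrite !inE; apply/exists_inP/orP.
      case=> [[i|j']] xS /=.
        by move=> nij; left; apply/exists_inP; exists i; rewrite ?inE.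
      by case/andP=> /eqP<- lj; right; rewrite negb_and lj orbT.
    case=> [/exists_inP[i]|]; rewrite ?inE.
      by exists (inl i).
    by case/andP=> + jS; rewrite jS /= => lj; exists (inr j); rewrite //= eqxx.
  have [B0|[j0 j0B]] := set_0Vmem B.
    rewrite Nr B0 cards0 addn0.
    have -> : inl @^-1: neighbours r S = A :\: As.
      apply/setP => i; rewrite !inE; apply/exists_inP/idP.
        case=> [[i'|j]] xS /=; last first.
          by have : j \in B; [rewrite inE|rewrite B0 inE].
        by case/andP=> /eqP<- li; rewrite xS li.
      case/andP => + iS; rewrite iS /= => li; exists (inl i) => //=.
      by rewrite eqxx.
    have -> : finset.set0 :\: Bs = finset.set0 by rewrite set0D.
    rewrite setU0 -[X in (X <= _)%N](cardsID As) addnC leq_add2l.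
    have /setIidPr-> : As \subset A by apply/subsetP=> i /[!inE]/andP[].
    have lmAs : {in As, forall i, lm i} by move=> i /[!inE]/andP[].
    apply: leq_trans (hallm As lmAs) _; apply: subset_leq_card.
    apply/subsetP=> j /[!inE] /exists_inP[i] /[!inE]/andP[iA _] nij.
    by apply/exists_inP; exists i; rewrite ?inE.
  have -> : inl @^-1: neighbours r S = [set: 'I_m].
    apply/setP=> i; rewrite !inE; apply/exists_inP; exists (inr j0) => //.
    by rewrite inE in j0B.
  (* the [ln]-points of [B] without neighbour in [A] have theirs outside [A] *)
  rewrite Nr cardsT -(cardsC A) -addnA leq_add2l.
  apply: (@leq_trans (#|Bs :\: NA| + #|NA :|: (B :\: Bs)|)); last first.
    rewrite leq_add2r.
    apply: leq_trans (halln (Bs :\: NA) _) _; first by move=> j /[!inE]/and3P[].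
    apply: subset_leq_card; apply/subsetP=> i; rewrite !inE.
    case/exists_inP=> j; rewrite !inE => /andP[nNA _] nij.
    by apply: contra nNA => iA; apply/exists_inP; exists i; rewrite ?inE.
  rewrite addnC -(cardsUI (NA :|: _)) (leq_trans _ (leq_addr _ _)) //.
  apply: subset_leq_card; apply/subsetP=> j jB; rewrite in_setU in_setU !in_setD.
  by rewrite jB andbT andbC; case: (j \in Bs); case: (j \in NA).
pose B1 := [set i | if f (inl i) is inr _ then true else false].
pose B2 := [set j | [exists i, f (inl i) == inr j]].
have h1 (i : {i | i \in B1}) :
    exists j : {j | j \in B2}, f (inl (val i)) = inr (val j).
  case: i => i /= iB; have := iB; rewrite inE; case fi : (f (inl i)) => [//|j] _.
  have jB : j \in B2 by rewrite inE; apply/existsP; exists i; rewrite fi.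
  by exists (exist _ j jB).
have h2 (j : {j | j \in B2}) :
    exists i : {i | i \in B1}, f (inl (val i)) = inr (val j).
  case: j => j /= jB; have := jB; rewrite inE => /existsP[i /eqP fi].
  have iB : i \in B1 by rewrite inE fi.
  by exists (exist _ i iB).
have [phi phiE] := fin_all_exists h1; have [psi psiE] := fin_all_exists h2.
exists B1, B2, phi; split.
- exists psi => x; apply: val_inj.
    suff [] : inl (val (psi (phi x))) = inl (val x) :> T by [].
    by apply: injf; rewrite psiE phiE.
  suff [] : inr (val (phi (psi x))) = inr (val x) :> T by [].
  by rewrite -phiE psiE.
- by move=> i; have := rf (inl (val i)); rewrite phiE.
- move=> i; rewrite inE; have := rf (inl i).
  by case: (f (inl i)) => //= i' /andP[].
- move=> j; rewrite inE negb_exists => /forallP nj.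
  have [g fK gK] := injF_bij injf.
  have := rf (g (inr j)); rewrite gK.
  case gj : (g (inr j)) => [i|j'] /=; last by case/andP=> /eqP->.
  by have := nj i; rewrite -gj gK eqxx.
Qed.

End CoveringMatching.

(** * Numerical comparison of bars *)

Section Points.
Variables (R : realType) (e : R).
Hypothesis e0 : 0 <= e.
Implicit Types P Q : R * \bar R.

Definition matchable P Q := (point_dist P Q <= e%:E)%E.

Definition long P := ((P.1 + e + e)%:E < P.2)%E.

(** The condition for a nonzero morphism from the interval module of [P] to that
    of [Q] shifted down by [e] to exist. *)
Definition shift_hom P Q :=
  [&& Q.1 <= P.1 + e, ((P.1 + e)%:E < Q.2)%E & (Q.2 <= P.2 + e%:E)%E].

(** Comparison of the sums of the coordinates, the bars with infinite death coming
    last, ordered by birth. *)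
Definition midpoint_le P Q := if P.2 == +oo%E
  then (Q.2 == +oo%E) && (P.1 <= Q.1)
  else (Q.2 == +oo%E) || (P.1 + fine P.2 <= Q.1 + fine Q.2).

Lemma midpoint_le_refl : reflexive midpoint_le.
Proof. by move=> P; rewrite /midpoint_le !lexx orbT andbT; case: ifP. Qed.

Lemma midpoint_le_trans : transitive midpoint_le.
Proof.
move=> Q P S; rewrite /midpoint_le.
case: (P.2 == _); case: (Q.2 == _); case: (S.2 == _) => //=; exact: le_trans.
Qed.

Lemma midpoint_le_total : total midpoint_le.
Proof.
move=> P Q; rewrite /midpoint_le.
by case: (P.2 == _); case: (Q.2 == _) => //=; apply: le_total.
Qed.

Lemma abs_diff_le (x y : \bar R) : x != -oo%E -> y != -oo%E ->
  (abs_diff x y <= e%:E)%E = (x <= y + e%:E)%E && (y <= x + e%:E)%E.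
Proof.
rewrite /abs_diff; case: x => [x| |] //; case: y => [y| |] // _ _ /=.
- rewrite eqe; case: eqP => [->|_]; rewrite ?lee_fin.
    by rewrite lerDl e0.
  by rewrite ler_distl andbC lerBlDr.
- by rewrite !leye_eq andbF.
Qed.

Lemma matchableE P Q : P.2 != -oo%E -> Q.2 != -oo%E -> matchable P Q =
  [&& P.1 <= Q.1 + e, Q.1 <= P.1 + e, (P.2 <= Q.2 + e%:E)%E
    & (Q.2 <= P.2 + e%:E)%E].
Proof.
move=> P2 Q2; rewrite /matchable /point_dist ge_max !abs_diff_le //.
by rewrite -!EFinD !lee_fin -!andbA.
Qed.

Lemma matchableC P Q : P.2 != -oo%E -> Q.2 != -oo%E ->
  matchable P Q = matchable Q P.
Proof. by move=> P2 Q2; rewrite !matchableE //; do 4!case: (_ <= _)%O. Qed.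

(** Going from [P] to [Q] and from [Q] to [S], births and deaths increase by at
    most [e] each time.  If [Q] is far from [P], one coordinate of [Q] is more
    than [e] below that of [P]; so the same coordinate of [S] is below that of
    [P], and by [midpoint_le] the other one is above by at least as much, which
    leaves no room for [Q] to be far from [S]. *)
Lemma matchable_of_shift_hom P Q S :
  P.2 != -oo%E -> Q.2 != -oo%E -> S.2 != -oo%E ->
  midpoint_le P S -> shift_hom P Q -> shift_hom Q S ->
  matchable P Q || matchable Q S.
Proof.
move=> P2 Q2 S2; rewrite !matchableE // /midpoint_le /shift_hom.
case: P P2 => p [p'| |] //= _; case: Q Q2 => q [q'| |] //= _;
  case: S S2 => s [s'| |] //= _; rewrite -?EFinD ?lee_fin ?lte_fin //=;
  rewrite ?leey ?ltey //= ?andbT.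
- move=> h1 /and3P[h2 h3 h4] /and3P[h5 h6 h7].
  have [] := boolP ((p <= q + e) && (p' <= q' + e)).
    by case/andP=> -> -> /=; rewrite h2 h4.
  rewrite negb_and -!ltNge => /orP h8.
  apply/orP; right; apply/and4P; split => //; case: h8 => h8; lra.
- by rewrite leye_eq /= !andbF.
- by rewrite leye_eq /= !andbF.
- by rewrite !leye_eq /= !andbF.
- by rewrite !leye_eq /= !andbF.
- move=> h1 h2 h3; apply/orP; case: (leP p (q + e)) => h.
    by left; rewrite h2.
  by right; rewrite h3 andbT; lra.
Qed.

(** For long bars the composite of the two nonzero morphisms of
    [matchable_of_shift_hom] is again nonzero: if [S] were dead at the birth of
    [P] shifted twice, both coordinates of [S] would be below those of [P],
    against [midpoint_le]. *)
Lemma alive_composite P S :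
  S.2 != -oo%E -> long P -> long S -> midpoint_le P S ->
  S.1 <= P.1 + e + e -> in_interval S (P.1 + e + e).
Proof.
rewrite /long /midpoint_le /in_interval.
case: P => p [p'| |] //=; case: S => s [s'| |] //= _; rewrite ?lte_fin ?ltey //=.
- by move=> h1 h2 h3 ->; rewrite andTb; lra.
- by move=> _ _ _ ->.
- by move=> _ _ _ ->.
Qed.

End Points.

(** * Algebraic stability *)

Lemma pt_nth (R : realType) (D : seq (R * \bar R)) (i : 'I_(size D)) :
  pt i = bar D i.
Proof. by rewrite /pt (tnth_nth (0, 0%E)). Qed.

Section Stability.
Variables (F : fieldType) (R : realType) (e : R).
Hypothesis e0 : 0 <= e.

Definition shift_morphism (V W : pvect F R)
    (f : forall t, 'Hom(pobj V t, pobj W (t + e))) :=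
  forall s t (st : s <= t) (st' : s + e <= t + e) x,
    f t (pmap V st x) = pmap W st' (f s x).

Definition half_inverse (V W : pvect F R)
    (f : forall t, 'Hom(pobj V t, pobj W (t + e)))
    (g : forall t, 'Hom(pobj W t, pobj V (t + e))) :=
  forall t (tt : t <= t + e + e) x, g (t + e) (f t x) = pmap V tt x.

Definition interleaved (V W : pvect F R) := exists f g,
  [/\ @shift_morphism V W f, @shift_morphism W V g, half_inverse f g
    & half_inverse g f].

Definition proper_diagram (D : seq (R * \bar R)) :=
  forall I, I \in D -> (I.1%:E < I.2)%E.

Lemma proper_bar D i : proper_diagram D -> (i < size D)%N ->
  ((bar D i).1%:E < (bar D i).2)%E.
Proof. by move=> pD iD; apply: pD; apply: mem_nth. Qed.

Lemma proper_bar_neqNy D i : proper_diagram D -> (i < size D)%N ->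
  (bar D i).2 != -oo%E.
Proof. by move=> pD iD; apply: contraTneq (proper_bar pD iD) => ->. Qed.

Section Coefficients.
Variables (V W : pvect F R) (D E : seq (R * \bar R)).
Variables (b : interval_basis V D) (b' : interval_basis W E).
Variable f : forall t, 'Hom(pobj V t, pobj W (t + e)).
Hypothesis fnat : shift_morphism f.
Hypothesis pD : proper_diagram D.

(** The component from bar [i] of [V] to bar [j] of [W] is determined by its
    value at the birth of bar [i], by naturality. *)
Definition shift_coef i j : F := coef b' j (f (bar D i).1 (gen b i (bar D i).1)).

Lemma shift_coef_alive i j : (j < size E)%N -> shift_coef i j != 0 ->
  in_interval (bar E j) ((bar D i).1 + e).
Proof. by move=> jE; apply: contraNT => dead; rewrite /shift_coef coef_dead. Qed.

Lemma shift_gen i t : (i < size D)%N -> (bar D i).1 <= t ->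
  f t (gen b i t) = \sum_(j < size E) shift_coef i j *: gen b' j (t + e).
Proof.
move=> iD bt; have bt' : (bar D i).1 + e <= t + e by rewrite lerD2r.
rewrite -(pmap_gen b bt iD (lexx _)) (fnat bt bt').
rewrite [f _ _](gen_coef b') linear_sum; apply: eq_bigr => j _.
rewrite linearZ /= -/(shift_coef i j).
have [->|ne0] := eqVneq (shift_coef i j) 0; first by rewrite !scale0r.
have /andP[bj _] := shift_coef_alive (ltn_ord j) ne0.
by rewrite pmap_gen.
Qed.

(** A nonzero component cannot outlive its source: at the death of bar [i] its
    generator is 0, hence so is its image, so bar [j] must be dead [e] later. *)
Lemma shift_coef_hom i j : (i < size D)%N -> (j < size E)%N ->
  shift_coef i j != 0 -> shift_hom e (bar D i) (bar E j).
Proof.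
move=> iD jE ne0; have /andP[bj dj] := shift_coef_alive jE ne0.
rewrite /shift_hom bj dj /= leNgt; apply/negP => lt_dd.
have := proper_bar pD iD.
case Di : (bar D i).2 lt_dd => [r| |] lt_dd bd; last 2 first.
- by move: lt_dd; rewrite addye // ltNge leey.
- by move: bd; rewrite ltNge leNye.
have br : (bar D i).1 <= r by rewrite -lee_fin ltW.
have := shift_gen iD br; rewrite (@gen_dead _ _ _ _ b i); last 2 first.
- by [].
- by rewrite /alive /in_interval Di ltxx andbF.
rewrite linear0 => /(congr1 (coef b' j (t := r + e))).
rewrite coef_at0 coef_lincomb (bigD1 (Ordinal jE)) //= big1 => [|j' j'j].
  rewrite coef_gen // eqxx /alive /in_interval lt_dd addr0 andbT /=.
  rewrite (le_trans bj) ?lerD2r // mulr1 => h; by rewrite -h eqxx in ne0.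
rewrite coef_gen //; suff /negPf-> : j != j' :> nat by rewrite mulr0.
by rewrite eq_sym.
Qed.

End Coefficients.

(** The composite of [f] and [g] is the structure map of [V], whose components are
    those of the identity; the product of two scalars is the scalar of the
    composite as soon as bar [i'] is alive where it is evaluated. *)
Lemma shift_coef_comp (V W : pvect F R) D E (b : interval_basis V D)
    (b' : interval_basis W E) f g i i' :
  shift_morphism f -> shift_morphism g -> half_inverse f g ->
  (i < size D)%N -> (i' < size D)%N ->
  in_interval (bar D i') ((bar D i).1 + e + e) ->
  \sum_(j < size E) shift_coef b b' f i j * shift_coef b' b g j i' = (i == i')%:R.
Proof.
move=> fnat gnat gf iD i'D al; set s := (bar D i).1.
have ss : s <= s + e + e by rewrite -addrA lerDl addr_ge0.
have := gf s ss (gen b i s); rewrite pmap_gen // (shift_gen b b' fnat) //.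
rewrite linear_sum => /(congr1 (coef b i' (t := s + e + e))).
rewrite coef_gen // /alive al andbT eq_sym => <-.
under [in RHS]eq_bigr => j _ do rewrite linearZ /=.
rewrite coef_lincomb; apply: eq_bigr => j _.
have [->|ne0] := eqVneq (shift_coef b b' f i j) 0; first by rewrite !mul0r.
have /andP[bj _] := shift_coef_alive (ltn_ord j) ne0.
rewrite (shift_gen b' b gnat) //; congr (_ * _).
rewrite coef_lincomb (bigD1 (Ordinal i'D)) //= big1 => [|k ki].
  by rewrite coef_gen // eqxx /alive al mulr1 addr0.
rewrite coef_gen //; suff /negPf-> : i' != k :> nat by rewrite mulr0.
by rewrite eq_sym.
Qed.

(** Hall's condition for the long bars (Bjerkevik's argument): the matrices of
    [f] and [g] restricted to [A] and to the bars matchable with it have a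
    product which is unitriangular for [midpoint_le]. *)
Lemma long_card (V W : pvect F R) D E f g (A : {set 'I_(size D)}) :
  interval_basis V D -> interval_basis W E ->
  proper_diagram D -> proper_diagram E ->
  @shift_morphism V W f -> @shift_morphism W V g -> half_inverse f g ->
  {in A, forall i, long e (pt i)} ->
  (#|A| <=
   #|[set j : 'I_(size E) | [exists i in A, matchable e (pt i) (pt j)]]|)%N.
Proof.
move=> b b' pD pE fnat gnat gf longA; set N := [set j | _].
apply: (@card_le_of_triangular F _ _ (fun i i' => midpoint_le (pt i) (pt i'))
  _ _ _ A N (fun i j => shift_coef b b' f i j)
  (fun j i => shift_coef b' b g j i)).
- by move=> i; apply: midpoint_le_refl.
- by move=> i i' i''; apply: midpoint_le_trans.
- by move=> i i'; apply: midpoint_le_total.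
move=> i i' iA i'A le_ii'.
have Ny (j : 'I_(size D)) : (bar D j).2 != -oo%E by apply: proper_bar_neqNy.
have NyE (j : 'I_(size E)) : (bar E j).2 != -oo%E by apply: proper_bar_neqNy.
have sumN : \sum_(j < size E) shift_coef b b' f i j * shift_coef b' b g j i' =
    \sum_(j in N) shift_coef b b' f i j * shift_coef b' b g j i'.
  rewrite [RHS]big_mkcond; apply: eq_bigr => j _; case: ifPn => // jN.
  apply/eqP; apply: contraNT jN; rewrite mulf_eq0 negb_or => /andP[fij gji].
  have h1 := shift_coef_hom fnat pD (ltn_ord i) (ltn_ord j) fij.
  have h2 := shift_coef_hom gnat pE (ltn_ord j) (ltn_ord i') gji.
  rewrite !pt_nth in le_ii'.
  rewrite inE; apply/exists_inP.
  have /orP[cl|cl] :=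
    matchable_of_shift_hom e0 (Ny i) (NyE j) (Ny i') le_ii' h1 h2.
    by exists i; rewrite ?pt_nth.
  by exists i'; rewrite ?pt_nth /= 1?(matchableC e0).
rewrite -sumN; have [bi'|bi'] := leP (bar D i').1 ((bar D i).1 + e + e).
  apply: shift_coef_comp => //.
  apply: alive_composite bi' => //; rewrite -?pt_nth //; exact: longA.
(* bar [i'] is born too late to receive anything *)
rewrite (_ : (i == i') = false) ?big1 // => [j _|]; last first.
  by apply/negbTE; apply: contraTneq bi' => ->; rewrite -leNgt; have := e0; lra.
apply/eqP; rewrite mulf_eq0 -[_ || _]negbK negb_or; apply/negP => /andP[fij gji].
have /andP[h1 _] := shift_coef_hom fnat pD (ltn_ord i) (ltn_ord j) fij.
have /andP[h2 _] := shift_coef_hom gnat pE (ltn_ord j) (ltn_ord i') gji.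
by move: bi'; rewrite ltNge => /negP; apply; move: h1 h2 => /=; lra.
Qed.

Lemma short_pers P : ~~ long e P -> ((2^-1)%:E * pers P <= e%:E)%E.
Proof.
rewrite /long /pers; case: P => p [p'| |] /=.
- by rewrite lte_fin -leNgt lee_fin => h; lra.
- by rewrite ltey.
- by move=> _; rewrite gt0_muleNy ?leNye // lte_fin invr_gt0.
Qed.

(** Algebraic stability: interleaved modules have diagrams at bottleneck distance
    at most [e], because a matching covering the long bars of both diagrams has
    cost at most [e]. *)
Theorem interleaved_bottleneck (V W : pvect F R) D E :
  is_diagram V D -> is_diagram W E -> interleaved V W ->
  (bottleneck D E <= e%:E)%E.
Proof.
move=> VD WE [f [g [fnat gnat gf fg]]].
have [pD _] := VD; have [pE _] := WE.
have b := is_diagram_basis VD; have b' := is_diagram_basis WE.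
have [||B1 [B2 [phi [bij cl un1 un2]]]] := @covering_matching (size D) (size E)
  (fun i j => matchable e (pt i) (pt j))
  (fun i => long e (pt i)) (fun j => long e (pt j)).
- move=> A; exact: long_card b b' pD pE fnat gnat gf.
- move=> B longB; apply: leq_trans (long_card b' b pE pD gnat fnat fg longB) _.
  apply: subset_leq_card; apply/subsetP => i; rewrite !inE.
  case/exists_inP=> j jB c; apply/exists_inP; exists j => //.
  by rewrite matchableC // pt_nth; apply: proper_bar_neqNy.
apply: le_trans (ereal_inf_lbound _) _.
  by exists B1, B2, phi; split; [exact: bij|reflexivity].
have e0E : (0 <= e%:E)%E by rewrite lee_fin.
rewrite /matching_cost !ge_max; apply/and3P; split; apply: bigmax_le => // i.
- by move=> _; apply: cl.
- by move=> iB; apply: short_pers; apply: un1.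
- by move=> iB; apply: short_pers; apply: un2.
Qed.

End Stability.

(** * Existence of persistence diagrams *)

Section DualBasis.
Variables (F : fieldType) (vT : vectType F) (B : seq vT).
Hypotheses (frB : free B) (spB : <<B>>%VS = fullv).

Definition dual_basis (b : vT) : 'Hom(vT, F^o) :=
  if insub (index b B) is Some i
  then linfun (coord (in_tuple B) i : vT -> F^o) else 0.

Lemma dual_basisE (i : 'I_(size B)) v :
  dual_basis B`_i v = coord (in_tuple B) i v.
Proof.
by rewrite /dual_basis index_uniq ?free_uniq // valK lfunE.
Qed.

Lemma dual_basis_sum v : v = \sum_(b <- B) dual_basis b v *: b.
Proof.
have vB : v \in <<in_tuple B>>%VS by rewrite spB memvf.
rewrite [LHS](coord_span vB) (big_nth 0) big_mkord; apply: eq_bigr => i _.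
by rewrite dual_basisE.
Qed.

Lemma dual_basis_delta b b' : b \in B -> b' \in B ->
  dual_basis b b' = (b == b')%:R.
Proof.
move=> /(nthP 0)[i iB <-] /(nthP 0)[j jB <-].
rewrite (dual_basisE (Ordinal iB)) -[j]/(val (Ordinal jB)).
rewrite -[nth 0 B _]/((in_tuple B)`_(Ordinal jB)) coord_free //.
by rewrite nth_uniq ?free_uniq // eq_sym.
Qed.

Lemma dual_basis_eq0 (W : {vspace vT}) b v :
  W = <<[seq b <- B | b \in W]>>%VS -> b \in B -> b \notin W -> v \in W ->
  dual_basis b v = 0.
Proof.
move=> WE bB bW vW; apply/eqP; rewrite -memv_ker.
apply: subvP vW; rewrite WE; apply/span_subvP => b'.
rewrite mem_filter => /andP[b'W b'B]; rewrite memv_ker dual_basis_delta //.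
by case: (b =P b') bW => [->|_ _]; rewrite ?b'W ?eqxx.
Qed.

End DualBasis.

Section FirstLevel.
Variables (R : realType) (rs : seq R).

(** The time from which an up-closed [P] holds, infinite if it never does, when
    the only times at which it may begin to hold are those of [rs]. *)
Definition first_level (P : pred R) : \bar R :=
  \big[mine/+oo%E]_(r <- rs | P r) r%:E.

Lemma first_level_neqNy P : first_level P != -oo%E.
Proof.
apply: (big_ind (fun x : \bar R => x != -oo%E)) => // x y.
by rewrite minEle; case: ifP.
Qed.

Lemma first_levelP (P : pred R) t : (forall s t, s <= t -> P s -> P t) ->
  (P t -> exists2 r, r \in rs & (r <= t) && P r) ->
  P t = (first_level P <= t%:E)%E.
Proof.
move=> upP witP.
have -> : (first_level P <= t%:E)%E = has (fun r => P r && (r <= t)) rs.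
  rewrite /first_level; elim: (rs) => [|r s IH]; first by rewrite big_nil leye_eq.
  by rewrite big_cons /=; case: (P r) => //=; rewrite ge_min lee_fin IH.
apply/idP/hasP => [/witP[r rrs /andP[rt Pr]]|[r _ /andP[Pr rt]]].
  by exists r; rewrite ?Pr.
exact: upP rt Pr.
Qed.

End FirstLevel.

Lemma quotv_pi_rep (F : fieldType) (vT : vectType F) (U V : {vspace vT}) v :
  v \in U -> v - vsval (quotv_pi U V v) \in V.
Proof.
move=> vU; have vUV : v \in (U + V)%VS by rewrite (subvP (addvSl U V)).
by rewrite val_quotv_pi -[v in v - _](addv_pi1_pi2 vUV) addrC addKr memv_pi2.
Qed.

Section Quotient.
Variables (F : fieldType) (R : realType) (vT : vectType F).
Variables (U V : R -> {vspace vT}) (rs : seq R).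

Definition finitely_determined (W : R -> {vspace vT}) :=
  forall t, W t = 0%VS \/ exists2 r, r \in rs & r <= t /\ W t = W r.

Hypothesis U_mono : forall s t, s <= t -> (U s <= U t)%VS.
Hypothesis V_mono : forall s t, s <= t -> (V s <= V t)%VS.
Hypothesis U_fin : finitely_determined U.
Hypothesis V_fin : finitely_determined V.

Lemma subspace_chain_levels (W : R -> {vspace vT}) :
  (forall s t, s <= t -> (W s <= W t)%VS) ->
  subspace_chain (0%VS :: [seq W r | r : R <- rs]).
Proof.
move=> W_mono A A'; rewrite !inE => /predU1P[->|/mapP[r _ ->]].
  by rewrite sub0v.
move=> /predU1P[->|/mapP[r' _ ->]]; first by rewrite sub0v orbT.
by have /orP[/W_mono->|/W_mono->] := le_total r r'; rewrite ?orbT.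
Qed.

Lemma mem_levels W t : finitely_determined W ->
  W t \in 0%VS :: [seq W r | r : R <- rs].
Proof.
move=> W_fin; rewrite inE; have [->|[r rrs [_ ->]]] := W_fin t.
  by rewrite eqxx.
by rewrite map_f ?orbT.
Qed.

Lemma level_mem (W : R -> {vspace vT}) b t :
  (forall s t, s <= t -> (W s <= W t)%VS) ->
  finitely_determined W -> b != 0 ->
  (b \in W t) = (first_level rs (fun r => b \in W r) <= t%:E)%E.
Proof.
move=> W_mono W_fin b0.
apply: (@first_levelP R rs (fun r => b \in W r)) => [r s rs'|bt].
  by apply/subvP/W_mono.
have [W0|[r rrs [rt WE]]] := W_fin t; first by rewrite W0 memv0 (negPf b0) in bt.
by exists r; rewrite // rt -WE.
Qed.

(* any proofs of functoriality: the module is determined by its maps *)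
Variable idp : forall (t : R) (tt : t <= t) x,
  quotv_map (U t) (V t) (U t) (V t) x = x.
Variable compp : forall (s t u : R)
    (st : s <= t) (tu : t <= u) (su : s <= u) x,
  quotv_map (U t) (V t) (U u) (V u) (quotv_map (U s) (V s) (U t) (V t) x) =
  quotv_map (U s) (V s) (U u) (V u) x.

(** Structure theorem for [U t / V t]: take a basis adapted to both filtrations.
    A basis vector is born when it enters [U] and dies when it enters [V], and
    the classes of the vectors in [U t] and not in [V t] form a basis of the
    quotient. *)
Lemma quotv_diagram : exists D, is_diagram
  (@PVect F R (fun t => quotv (U t) (V t))
     (fun s t _ => quotv_map (U s) (V s) (U t) (V t)) idp compp) D.
Proof.
set Q := PVect _ _.
have [B [frB spB spanB]] := common_adapted_basis
  (subspace_chain_levels U_mono) (subspace_chain_levels V_mono).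
have spanU t : U t = <<[seq b <- B | b \in U t]>>%VS.
  by apply: spanB; rewrite mem_cat; apply/orP; left; apply: mem_levels.
have spanV t : V t = <<[seq b <- B | b \in V t]>>%VS.
  by apply: spanB; rewrite mem_cat; apply/orP; right; apply: mem_levels.
pose birth b := first_level rs (fun r => b \in U r).
pose death b := first_level rs (fun r => b \in V r).
pose B' := [seq b <- B | (birth b < death b)%E].
pose D := [seq (fine (birth b), death b) | b <- B'].
have sD : size D = size B' by rewrite size_map.
have uB' : uniq B' by rewrite filter_uniq ?free_uniq.
have birthB b : b \in B' -> (fine (birth b))%:E = birth b.
  rewrite mem_filter => /andP[bd _]; apply: fineK.
  by rewrite fin_numE first_level_neqNy (lt_eqF (lt_le_trans bd (leey _))).
have B'B b : b \in B' -> b \in B by rewrite mem_filter => /andP[].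
have B0 b : b \in B -> b != 0 := free_not0 frB.
have memU b t : b \in B -> (b \in U t) = (birth b <= t%:E)%E.
  by move=> /B0; apply: level_mem.
have memV b t : b \in B -> (b \in V t) = (death b <= t%:E)%E.
  by move=> /B0; apply: level_mem.
have nthD i : (i < size D)%N -> bar D i = (fine (birth B'`_i), death B'`_i).
  by move=> iD; rewrite (nth_map 0) -?sD.
have nthB' i : (i < size D)%N -> B'`_i \in B' by rewrite sD; apply: mem_nth.
have aliveE i t : (i < size D)%N ->
    alive D i t = (B'`_i \in U t) && (B'`_i \notin V t).
  move=> iD; have bB' := nthB' i iD; have bB := B'B _ bB'.
  by rewrite /alive /in_interval nthD //= -lee_fin birthB // memU // memV // ltNge.
exists D; apply: basis_is_diagram.
  move=> I /mapP[b bB' ->] /=; rewrite birthB //.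
  by move: bB'; rewrite mem_filter => /andP[].
pose e i t : pobj Q t := if B'`_i \in U t then quotv_pi (U t) (V t) B'`_i else 0.
pose c i t (x : pobj Q t) : F :=
  if alive D i t then dual_basis B B'`_i (vsval x) else 0.
apply: (@IntervalBasis F R Q D e c).
- move=> i t a x y; rewrite /c; case: ifP => _; last by rewrite scaler0 addr0.
  by rewrite !linearP.
- move=> t x; pose v := vsval x.
  have vU : v \in U t by apply: (subvP (diffvSl (U t) (V t))); apply: subvsP.
  transitivity (\sum_(b <- B | (b \in U t) && (b \notin V t))
      dual_basis B b v *: quotv_pi (U t) (V t) b).
    rewrite -[LHS](quotv_piK x) -/v [X in quotv_pi _ _ X](dual_basis_sum frB spB v).
    rewrite linear_sum [RHS]big_mkcond big_seq [RHS]big_seq.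
    apply: eq_bigr => b bB; rewrite linearZ /=.
    have [bU|bU] := boolP (b \in U t); last first.
      by rewrite (dual_basis_eq0 frB (spanU t)) // scale0r.
    have [bV|bV//] := boolP (b \in V t).
    have /eqP-> : quotv_pi (U t) (V t) b == 0 by rewrite quotv_pi_eq0.
    by rewrite scaler0.
  transitivity (\sum_(b <- B' | (b \in U t) && (b \notin V t))
      dual_basis B b v *: quotv_pi (U t) (V t) b).
    rewrite big_filter_cond big_seq_cond [RHS]big_seq_cond; apply: eq_bigl => b.
    have [bB|//] := boolP (b \in B); rewrite andTb.
    case: (boolP (_ && _)) => [/andP[]|]; last by rewrite !andbF.
    by rewrite memU // memV // -ltNge => bt td; rewrite (le_lt_trans bt td).
  rewrite big_mkcond (big_nth 0) big_mkord sD; apply: eq_bigr => i _.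
  have iD : (i < size D)%N by rewrite sD.
  by rewrite /c /e aliveE //; case: ifP => [/andP[-> _]//|_]; rewrite scale0r.
- move=> i j t iD jD; rewrite /c aliveE //.
  case: (boolP (_ && _)) => [/andP[iU iV]|_]; last by rewrite andbF.
  have [iB jB] := (B'B _ (nthB' i iD), B'B _ (nthB' j jD)).
  rewrite andbT /e; case: ifPn => jU; last first.
    by rewrite !linear0; case: eqP jU => // <-; rewrite iU.
  have /(dual_basis_eq0 frB (spanV t) iB iV) := quotv_pi_rep (V t) jU.
  move/eqP; rewrite linearB subr_eq0 => /eqP <-.
  by rewrite /= dual_basis_delta // nth_uniq -?sD.
- move=> i s t st iD; rewrite nthD //= -lee_fin birthB ?nthB' //.
  rewrite -memU ?B'B ?nthB' // => bs.
  rewrite /e bs (subvP (U_mono st)) //.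
  by apply: etrans (quotv_mapE _ _ _) _; rewrite ?U_mono ?V_mono.
Qed.

End Quotient.

(** * Sliding vertices in a simplicial complex *)

Lemma sum_antisym (F : fieldType) (I : finType) (b : I -> I -> F) :
  (forall x, b x x = 0) -> (forall x y, b x y = - b y x) ->
  \sum_x \sum_y b x y = 0.
Proof.
move=> b0 bN.
pose lt (x y : I) := (enum_rank x < enum_rank y)%N.
have -> : \sum_x \sum_y b x y =
    \sum_x \sum_y (if lt x y then b x y else 0) +
    \sum_x \sum_y (if lt y x then b x y else 0).
  rewrite -big_split; apply: eq_bigr => x _; rewrite -big_split /=.
  apply: eq_bigr => y _; rewrite /lt.
  case: (ltngtP (enum_rank x) (enum_rank y)); rewrite ?addr0 ?add0r // => /ord_inj.
  by move=> /enum_rank_inj->.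
rewrite [X in _ + X]exchange_big -big_split big1 // => x _.
rewrite -big_split big1 //= => y _; case: ifP => _; last by rewrite addr0.
by rewrite bN addNr.
Qed.

Section VertexPos.
Variable Z : finType.
Implicit Types (x y q : Z) (t : {set Z}).

Lemma vertex_posU1 q x t : x \notin t ->
  vertex_pos q (x |: t) = ((enum_rank x < enum_rank q)%N + vertex_pos q t)%N.
Proof.
move=> xt; rewrite /vertex_pos (cardsD1 x) !inE eqxx /=; congr addn.
apply: eq_card => y; rewrite !inE; case: eqP => //= ->.
by rewrite (negPf xt).
Qed.

Lemma vertex_posD1 q x t : x \in t ->
  vertex_pos q t = ((enum_rank x < enum_rank q)%N + vertex_pos q (t :\ x))%N.
Proof. by move=> xt; rewrite -[in LHS](setD1K xt) vertex_posU1 // !inE eqxx. Qed.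

End VertexPos.

Section ChainOps.
Variables (F : fieldType) (Z : finType).
Implicit Types (L : {set {set Z}}) (s t : {set Z}).

Local Notation chain := {ffun {set Z} -> F^o}.
Local Notation bd := (boundary F Z).
Implicit Type c : chain.

Definition simplex_span n L : {vspace chain} :=
  <<[seq simplex_chain F s | s : {set Z} <- enum L & #|s| == n]>>%VS.

Lemma chain_sum c : c = \sum_s c s *: simplex_chain F s.
Proof.
apply/ffunP => t; rewrite sum_ffunE (bigD1 t) //= !ffunE eqxx big1 => [|s st].
  by rewrite addr0 [_ *: _]mulr1.
by rewrite !ffunE eq_sym (negPf st) scaler0.
Qed.

Lemma simplex_spanP n L c :
  reflect (forall s, c s != 0 -> s \in L /\ #|s| = n) (c \in simplex_span n L).
Proof.
apply: (iffP idP) => [cL s|carr]; last first.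
  rewrite (chain_sum c); apply: memv_suml => s _.
  have [->|/carr[sL sn]] := eqVneq (c s) 0; first by rewrite scale0r mem0v.
  rewrite memvZ // memv_span //; apply: map_f.
  by rewrite mem_filter mem_enum sL sn eqxx.
apply: contraPP => nL; apply/negP; rewrite negbK.
move: cL; rewrite /simplex_span; set X := map _ _ => cL.
have := @coord_span _ _ _ (in_tuple X) c cL => ->.
rewrite sum_ffunE big1 // => i _; rewrite ffunE.
have /mapP[u] : X`_i \in X by apply: mem_nth.
rewrite mem_filter mem_enum => /andP[/eqP un uL] /= ->.
rewrite ffunE; case: eqP => [su|_]; last by rewrite scaler0.
by case: nL; rewrite su.
Qed.

Definition face_closed L := forall s t, s \in L -> t \subset s ->
  t != finset.set0 -> t \in L.

Lemma boundaryE c t : bd c t = if t == finset.set0 then 0 else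
    \sum_(x | x \notin t) (-1) ^+ vertex_pos x t * c (x |: t).
Proof. by rewrite lfunE /= ffunE. Qed.

Lemma sum_neq0 (I : finType) (P : pred I) (G : I -> F) :
  \sum_(i | P i) G i != 0 -> exists2 i, P i & G i != 0.
Proof.
move=> sum0; apply/exists_inP; apply: contraNT sum0.
rewrite negb_exists_in => /forall_inP G0; apply/eqP/big1 => i Pi.
by apply/eqP; have := G0 i Pi; rewrite negbK.
Qed.

Lemma boundary_span n L c : face_closed L ->
  c \in simplex_span n.+1 L -> bd c \in simplex_span n L.
Proof.
move=> fcL /simplex_spanP cL; apply/simplex_spanP => t; rewrite boundaryE.
have [|t0] := eqVneq t finset.set0; first by rewrite eqxx.
case/sum_neq0 => x xt; rewrite mulf_eq0 negb_or => /andP[_ /cL[xtL]].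
rewrite cardsU1 xt => -[tn]; split=> //.
by apply: fcL xtL _ t0; apply: subsetUr.
Qed.

(** The terms removing two vertices in the two possible orders cancel. *)
Lemma boundary_boundary c : bd (bd c) = 0.
Proof.
apply/ffunP => t; rewrite boundaryE [RHS]ffunE.
have [//|t0] := eqVneq t finset.set0.
pose b x y : F := if [&& x \notin t, y \notin t & x != y] then
    (-1) ^+ vertex_pos x t *
      ((-1) ^+ vertex_pos y (x |: t) * c (y |: (x |: t))) else 0.
transitivity (\sum_x \sum_y b x y); last first.
  apply: sum_antisym => [x|x y]; first by rewrite /b eqxx !andbF.
  rewrite /b [y == x]eq_sym; case: (boolP (x \in t)) => xt.
    by rewrite andbF oppr0.
  case: (boolP (y \in t)) => yt; first by rewrite oppr0.
  have [_|xy] /= := eqVneq x y; first by rewrite oppr0.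
  rewrite !vertex_posU1 // !mulrA -!exprD setUCA -mulNr; congr (_ * _).
  have : enum_rank x != enum_rank y by rewrite (inj_eq enum_rank_inj).
  rewrite -val_eqE /= => rxy; rewrite addnCA exprD [in RHS]addnCA [in RHS]exprD.
  rewrite [in RHS]addnC; case: ltngtP rxy => //= _ _.
    by rewrite expr0 expr1 mulN1r mul1r.
  by rewrite expr0 expr1 mulN1r mul1r opprK.
rewrite big_mkcond; apply: eq_bigr => x _; rewrite /b.
case: ifP => xt; last by rewrite big1.
rewrite boundaryE (_ : (x |: t == finset.set0) = false); last first.
  by apply/negbTE/set0Pn; exists x; rewrite setU11.
rewrite mulr_sumr big_mkcond; apply: eq_bigr => y _.
by rewrite !inE negb_or [y == x]eq_sym andbC.
Qed.

Section Slide.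
Variables p q : Z.
Hypothesis pq : p != q.

(** The exterior product by the vertex [q] of the part of [c] carried by the
    simplices containing [p]. *)
Definition cone_fun (c : chain) : chain :=
  [ffun t : {set Z} => if (p \in t) && (q \in t)
             then (-1) ^+ vertex_pos q t * c (t :\ q) else 0].

Lemma cone_is_linear : linear cone_fun.
Proof.
move=> a c c'; apply/ffunP=> t; rewrite !ffunE.
case: ifP => _; last by rewrite scaler0 addr0.
by rewrite mulrDr /GRing.scale /= mulrCA.
Qed.

HB.instance Definition _ :=
  GRing.isSemilinear.Build F chain chain _ cone_fun
    (GRing.semilinear_linear cone_is_linear).

Definition cone : 'End(chain) := linfun cone_fun.

Lemma coneE c (t : {set Z}) : cone c t = if (p \in t) && (q \in t)
   then (-1) ^+ vertex_pos q t * c (t :\ q) else 0.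
Proof. by rewrite lfunE /= ffunE. Qed.

(** The chain map induced by moving the vertex [p] to [q].  Taking this formula as
    the definition makes it homotopic to the identity by construction, and spares
    the signs of the induced map on oriented simplices. *)
Definition slide : 'End(chain) := (\1 - (bd \o cone) - (cone \o bd))%VF.

Lemma slideE c : slide c = c - bd (cone c) - cone (bd c).
Proof. by rewrite 2!add_lfunE !opp_lfunE id_lfunE !comp_lfunE. Qed.

(** On simplices containing [p], the boundary and the exterior product by [q]
    satisfy the Leibniz rule, which says that [c] is the sum of the two terms
    subtracted from it. *)
Lemma slide_vanish c (t : {set Z}) : p \in t -> slide c t = 0.
Proof.
move=> pt; have t0 : t != finset.set0 by apply/set0Pn; exists p.
rewrite slideE !ffunE; apply/eqP; rewrite -addrA -opprD subr_eq0; apply/eqP.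
rewrite boundaryE (negPf t0) coneE pt andTb.
have xtp x : p \in x |: t by rewrite !inE pt orbT.
have [qt|qt] := boolP (q \in t); last first.
  rewrite addr0 (bigD1 q) //= big1 => [|x /andP[xt xq]]; last first.
    by rewrite coneE !inE (negPf qt) orbF [q == x]eq_sym (negPf xq) andbF mulr0.
  rewrite coneE xtp setU11 /= setU1K // vertex_posU1 // ltnn mulrA.
  by rewrite -exprD addnn -signr_odd odd_double expr0 mul1r addr0.
have tq0 : t :\ q != finset.set0 by apply/set0Pn; exists p; rewrite !inE pq.
rewrite boundaryE (negPf tq0) [X in _ + _ * X](bigD1 q) /=; last first.
  by rewrite !inE eqxx.
rewrite setD1K // mulrDr mulrA.
rewrite [vertex_pos q t](vertex_posD1 q qt) ltnn add0n -exprD addnn -signr_odd.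
rewrite odd_double expr0 mul1r addrCA mulr_sumr.
rewrite [X in _ = _ + (_ + X)](eq_bigl (fun x => x \notin t)) => [|x]; last first.
  by rewrite !inE negb_and negbK; case: eqP => [->|_]; rewrite ?qt ?andbF ?andbT.
rewrite -big_split big1 ?addr0 // => x xt /=.
have xq : x != q by apply: contraNneq xt => ->.
rewrite coneE xtp !inE qt orbT /= mulrA -exprD [in X in _ + X]mulrA -exprD.
have -> : (x |: t) :\ q = x |: (t :\ q).
  apply/setP=> y; rewrite !inE; case: eqP => // ->.
  by rewrite eq_sym (negPf xq).
rewrite vertex_posU1 // (vertex_posD1 x qt) (vertex_posD1 q qt) ltnn add0n.
have : enum_rank x != enum_rank q by rewrite (inj_eq enum_rank_inj).
rewrite -val_eqE /= -mulrDl => rxq; apply/eqP; rewrite mulf_eq0; apply/orP; left.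
rewrite addnACA [(vertex_pos q _ + _)%N]addnC.
have -> : ((enum_rank q < enum_rank x)%N + (enum_rank x < enum_rank q)%N = 1)%N.
  by case: ltngtP rxq.
by rewrite add1n exprS mulN1r addNr.
Qed.

(** For a complex [L] this says that [p] is dominated by [q]. *)
Definition absorbs L := forall s, s \in L -> p \in s -> q |: s \in L.

Lemma cone_span n L c : absorbs L -> c \in simplex_span n L ->
  cone c \in simplex_span n.+1 L.
Proof.
move=> abL /simplex_spanP cL; apply/simplex_spanP => t; rewrite coneE.
case: ifP => [/andP[pt qt]|]; last by rewrite eqxx.
rewrite mulf_eq0 negb_or => /andP[_ /cL[tL tn]].
by rewrite -(setD1K qt) abL // ?inE ?pq // cardsU1 tn !inE eqxx.
Qed.

Lemma slide_span n L c :
  face_closed L -> absorbs L -> c \in simplex_span n.+1 L ->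
  slide c \in simplex_span n.+1 [set s in L | p \notin s].
Proof.
move=> fcL abL cL.
have /simplex_spanP sL : slide c \in simplex_span n.+1 L.
  by rewrite slideE !rpredB ?cone_span ?boundary_span // cone_span.
apply/simplex_spanP => t st; have [tL tn] := sL t st.
split=> //; rewrite inE tL /=; apply: contraNN st => pt.
by rewrite slide_vanish.
Qed.

Lemma slide_id c : (forall t, p \in t -> c t = 0) -> slide c = c.
Proof.
move=> c0.
have cone0 (d : chain) : (forall t, p \in t -> d t = 0) -> cone d = 0.
  move=> d0; apply/ffunP => t; rewrite coneE ffunE; case: ifP => // /andP[pt _].
  by rewrite d0 ?mulr0 // !inE pq.
rewrite slideE !cone0 ?linear0 ?oppr0 ?addr0 // => t pt.
rewrite boundaryE; case: ifP => // _; rewrite big1 // => x _.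
by rewrite c0 ?mulr0 // !inE pt orbT.
Qed.

Lemma slide_boundary c : slide (bd c) = bd (slide c).
Proof.
by rewrite !slideE !linearB /= !boundary_boundary !linear0 ?oppr0 ?addr0.
Qed.

End Slide.

(** The slides of all the vertices of [ps], composed: the result pushes every
    complex in which each [p] is dominated by [q p] into its part avoiding [ps],
    and is homotopic to the identity there. *)
Lemma slides (q : Z -> Z) (ps : seq Z) : {in ps, forall p, q p \notin ps} ->
  exists r : 'End(chain), [/\ forall c, r (bd c) = bd (r c),
    forall c, (forall t, has (mem t) ps -> c t = 0) -> r c = c &
    forall L, face_closed L -> {in ps, forall p, absorbs p (q p) L} ->
    (forall n c, c \in simplex_span n.+1 L ->
       r c \in simplex_span n.+1 [set s in L | ~~ has (mem s) ps]) /\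
    (forall n c, c \in simplex_span n.+1 L -> bd c = 0 ->
       exists2 d, d \in simplex_span n.+2 L & r c - c = bd d)].
Proof.
elim: ps => [|p ps IH] qps.
  exists \1%VF; split=> [c|c _|L fcL _]; rewrite ?id_lfunE //.
  split=> n c; rewrite id_lfunE.
    rewrite (_ : [set s in L | _] = L) //.
    by apply/setP=> s; rewrite !inE andbT.
  by exists 0; rewrite ?mem0v // subrr linear0.
have [|r [rbd rid rL]] := IH.
  by move=> x xps; have := qps x; rewrite !inE xps orbT => /(_ isT)/norP[].
have /norP[pqp qpps] : ~~ ((q p == p) || (q p \in ps)).
  by rewrite -in_cons qps ?mem_head.
have {}pqp : p != q p by rewrite eq_sym.
exists (slide p (q p) \o r)%VF; split=> [c|c c0|L fcL abL].
- by rewrite !comp_lfunE rbd slide_boundary.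
- rewrite comp_lfunE rid => [|t tps]; last by rewrite c0 //= tps orbT.
  by rewrite slide_id // => t pt; rewrite c0 //= pt.
have [|r1 r2] := rL L fcL.
  by move=> x xps; apply: abL; rewrite inE xps orbT.
pose L1 := [set s in L | ~~ has (mem s) ps].
have fcL1 : face_closed L1.
  move=> s t /[!inE] /andP[sL sps] ts t0; rewrite (fcL s) //=.
  apply: contra sps => /hasP[x xps xt]; apply/hasP; exists x => //.
  exact: (subsetP ts).
have abL1 : absorbs p (q p) L1.
  move=> s /[!inE] /andP[sL sps] ps'; rewrite abL ?mem_head //=.
  apply: contra sps => /hasP[x xps] /=; rewrite !inE => /predU1P[xq|xs].
    by rewrite -xq xps in qpps.
  by apply/hasP; exists x.
split=> n c cL; rewrite !comp_lfunE.
  have := slide_span pqp fcL1 abL1 (r1 n c cL).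
  rewrite (_ : [set s in L1 | _] = [set s in L | ~~ has (mem s) (p :: ps)]) //.
  by apply/setP=> s; rewrite !inE /= negb_or -andbA; congr andb; rewrite andbC.
move=> c0; have [d dL rcE] := r2 n c cL c0.
have rc0 : bd (r c) = 0 by rewrite -rbd c0 linear0.
exists (d - cone p (q p) (r c)).
  rewrite rpredB //.
  have /simplex_spanP sp := cone_span pqp abL1 (r1 n c cL).
  by apply/simplex_spanP => s /sp[] /[!inE] /andP[].
rewrite slideE rc0 linear0 subr0 linearB /= -rcE.
by rewrite addrAC.
Qed.

End ChainOps.

(** * Retraction onto a monotone section *)

Section Retraction.
Variables (F : fieldType) (X Z : finType) (i : X -> Z) (phi : Z -> X).
Hypothesis iK : cancel i phi.
Hypothesis i_mono : forall x y,
  (enum_rank (i x) < enum_rank (i y))%N = (enum_rank x < enum_rank y)%N.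

Local Notation chain T := {ffun {set T} -> F^o}.

Implicit Types (s : {set X}) (t : {set Z}) (c : chain X) (d : chain Z).

Let i_inj : injective i := can_inj iK.

(** The order of vertices fixes the orientation of simplices, so for a
    monotone [i] the induced chain map carries no sign. *)
Definition push_fun (c : chain X) : chain Z :=
  [ffun t : {set Z} => if t == i @: (i @^-1: t) then c (i @^-1: t) else 0].

Lemma push_is_linear : linear push_fun.
Proof.
move=> a c c'; apply/ffunP=> t; rewrite !ffunE.
by case: ifP => _ //; rewrite scaler0 addr0.
Qed.

HB.instance Definition _ :=
  GRing.isSemilinear.Build F (chain X) (chain Z) _ push_fun
    (GRing.semilinear_linear push_is_linear).

Definition push : 'Hom(chain X, chain Z) := linfun push_fun.

Lemma pushE c t : push c t = if t == i @: (i @^-1: t) then c (i @^-1: t) else 0.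
Proof. by rewrite lfunE /= ffunE. Qed.

Definition pull_fun (c : chain Z) : chain X := [ffun s : {set X} => c (i @: s)].

Lemma pull_is_linear : linear pull_fun.
Proof. by move=> a c c'; apply/ffunP=> t; rewrite !ffunE. Qed.

HB.instance Definition _ :=
  GRing.isSemilinear.Build F (chain Z) (chain X) _ pull_fun
    (GRing.semilinear_linear pull_is_linear).

Definition pull : 'Hom(chain Z, chain X) := linfun pull_fun.

Lemma pullE d s : pull d s = d (i @: s).
Proof. by rewrite lfunE /= ffunE. Qed.

Lemma preimset_imset s : i @^-1: (i @: s) = s.
Proof. by apply/setP => x; rewrite inE mem_imset. Qed.

Lemma push_pull_id c : pull (push c) = c.
Proof. by apply/ffunP => s; rewrite pullE pushE preimset_imset eqxx. Qed.

Definition in_image : {set {set Z}} :=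
  [set t : {set Z} | t == i @: (i @^-1: t)].

Lemma pull_push_id d :
  (forall t, d t != 0 -> t \in in_image) -> push (pull d) = d.
Proof.
move=> dim; apply/ffunP => t; rewrite pushE pullE.
case: eqP => [<-//|nt]; apply/esym/eqP/negPn/negP => /dim.
by rewrite inE => /eqP.
Qed.

Lemma in_imageP t : reflect (exists s, t = i @: s) (t \in in_image).
Proof.
rewrite inE; apply: (iffP eqP) => [->|[s ->]]; first by exists (i @^-1: t).
by rewrite preimset_imset.
Qed.

Lemma in_image_sub t z : t \in in_image -> z \in t -> z = i (phi z).
Proof. by case/in_imageP => s -> /imsetP[x _ ->]; rewrite iK. Qed.

Lemma in_imageT t : {in t, forall z, z = i (phi z)} -> t \in in_image.
Proof.
move=> tP; apply/in_imageP; exists (i @^-1: t); apply/setP => z.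
apply/idP/imsetP => [zt|[x /[!inE] xt ->//]].
by exists (phi z); rewrite ?inE -?tP.
Qed.

Lemma push_image c t : push c t != 0 -> t \in in_image.
Proof. by rewrite pushE inE; case: ifP => //; rewrite eqxx. Qed.

Lemma pull_span n (L : {set {set X}}) (L' : {set {set Z}}) (c : chain Z) :
  (forall s, i @: s \in L' -> s \in L) ->
  c \in simplex_span F n L' -> pull c \in simplex_span F n L.
Proof.
move=> LL' /simplex_spanP cL; apply/simplex_spanP => t.
by rewrite pullE => /cL[/LL' tL]; rewrite card_imset.
Qed.

Lemma vertex_pos_imset x s : vertex_pos (i x) (i @: s) = vertex_pos x s.
Proof.
rewrite /vertex_pos -(card_imset _ i_inj); apply: eq_card => z; rewrite !inE.
apply/andP/imsetP => [[/imsetP[y ys ->]]|[y /[!inE] /andP[ys yx] ->]].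
  by rewrite i_mono => yx; exists y; rewrite // inE ys.
by rewrite i_mono mem_imset.
Qed.

Lemma pull_boundary d : (forall t, d t != 0 -> t \in in_image) ->
  pull (boundary F Z d) = boundary F X (pull d).
Proof.
move=> dim; apply/ffunP => s; rewrite pullE !boundaryE.
rewrite -cards_eq0 card_imset // cards_eq0; case: ifP => // _.
transitivity (\sum_(z in i @: (~: s))
    (-1) ^+ vertex_pos z (i @: s) * d (z |: i @: s)).
  rewrite big_mkcond [RHS]big_mkcond; apply: eq_bigr => z _.
  have [/imsetP[x xs ->]|zs] := boolP (z \in i @: s).
    by rewrite mem_imset // inE xs.
  have [//|zs'] := boolP (z \in i @: ~: s).
  have [->|/dim /in_image_sub/(_ (setU11 _ _)) zE] := eqVneq (d (z |: i @: s)) 0.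
    by rewrite mulr0.
  by move: zs zs'; rewrite zE !mem_imset // inE => ->.
rewrite big_imset /= => [|x y _ _]; last exact: i_inj.
apply: eq_big => [x|x xs]; first by rewrite inE.
by rewrite vertex_pos_imset pullE imsetU1.
Qed.

Lemma boundary_image d : (forall t, d t != 0 -> t \in in_image) ->
  forall t, boundary F Z d t != 0 -> t \in in_image.
Proof.
move=> dim t; rewrite boundaryE; case: ifP => [_|_]; first by rewrite eqxx.
case/sum_neq0 => z _; rewrite mulf_eq0 negb_or => /andP[_ /dim zt].
by apply: in_imageT => y yt; apply: in_image_sub zt _; rewrite inE yt orbT.
Qed.

Lemma push_boundary c : push (boundary F X c) = boundary F Z (push c).
Proof.
rewrite -[in LHS](push_pull_id c) -pull_boundary; last exact: push_image.
by apply: pull_push_id; apply: boundary_image; exact: push_image.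
Qed.

Definition pullback (L : {set {set X}}) : {set {set Z}} :=
  [set t | (t != finset.set0) && (phi @: t \in L)].

Lemma imset_pullback s (L : {set {set X}}) :
  s != finset.set0 -> s \in L -> i @: s \in pullback L.
Proof.
move=> s0 sL; rewrite inE -cards_eq0 card_imset // cards_eq0 s0 /=.
by rewrite -imset_comp (eq_imset _ iK) imset_id.
Qed.

(** Every vertex [z] is dominated by [i (phi z)] in a pulled back complex: adding
    it to a simplex does not change the image under [phi].  Sliding all vertices
    into the image of [i] is therefore a homotopy inverse of [push]. *)
Lemma pullback_retraction : exists r : 'Hom(chain Z, chain X),
  [/\ forall c, r (push c) = c &
   forall L, face_closed L -> forall k,
   [/\ {in chains F k (pullback L), forall d, r d \in chains F k L},
      {in chains F k (pullback L), forall d,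
         r (boundary F Z d) = boundary F X (r d)} &
      {in cycles F k (pullback L), forall d,
         push (r d) - d \in boundaries F k (pullback L)}]].
Proof.
pose ps := enum [set z | z != i (phi z)]; pose q z := i (phi z).
have psE z : (z \in ps) = (z != i (phi z)) by rewrite mem_enum inE.
have qps : {in ps, forall p, q p \notin ps}.
  by move=> p _; rewrite psE negbK /q iK.
have imE (t : {set Z}) : ~~ has (mem t) ps -> t \in in_image.
  move=> nt; apply: in_imageT => z zt; apply/eqP; apply: contraNT nt => zi.
  by apply/hasP; exists z; rewrite // psE.
have [r [rbd rid rL]] := slides F qps.
exists (pull \o r)%VF; split=> [c|L fcL k].
  rewrite comp_lfunE rid ?push_pull_id // => t /hasP[z]; rewrite psE => zi /= zt.
  apply/eqP; apply: contraNT zi => /push_image /in_image_sub/(_ zt) <-.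
  exact: eqxx.
have fcP : face_closed (pullback L).
  move=> s t /[!inE] /andP[s0 sL] ts t0; rewrite t0; apply: fcL sL _ _.
    exact: imsetS.
  by apply/set0Pn; have /set0Pn[z zt] := t0; exists (phi z); apply: imset_f.
have abP : {in ps, forall p, absorbs p (q p) (pullback L)}.
  move=> p _ s /[!inE] /andP[s0 sL] ps'; apply/andP; split.
    by apply/set0Pn; exists (q p); rewrite setU11.
  rewrite imsetU1 /q iK (setUidPr _) // sub1set; exact: imset_f.
have [r1 r2] := rL _ fcP abP.
have rim n d : d \in simplex_span F n.+1 (pullback L) ->
    forall t, r d t != 0 -> t \in in_image.
  by move=> /r1/simplex_spanP cP t /cP[] /[!inE] /andP[_ /imE /[!inE]].
split=> c cL.
- rewrite comp_lfunE.
  apply: (pull_span (L' := [set s in pullback L | ~~ has (mem s) ps])).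
    move=> s /[!inE] /andP[/andP[_ +] _].
    by rewrite -imset_comp (eq_imset _ iK) imset_id.
  exact: r1.
- by rewrite !comp_lfunE rbd pull_boundary //; apply: rim cL.
- move: cL; rewrite memv_cap memv_ker => /andP[cL /eqP c0].
  rewrite comp_lfunE pull_push_id; last exact: rim cL.
  by have [d dL ->] := r2 k c cL c0; apply: memv_img.
Qed.

End Retraction.

(** * Interleaving of persistent homology *)

Section Induced.
Variables (F : fieldType) (vT wT : vectType F).

Definition quotv_hom (h : 'Hom(vT, wT)) U V U' V' :
    'Hom(quotv U V, quotv U' V') :=
  (quotv_pi U' V' \o h \o linfun (@vsval F vT (U :\: V)%VS))%VF.

Lemma quotv_homE (h : 'Hom(vT, wT)) U V U' V' v :
  (h @: U <= U')%VS -> (h @: V <= V')%VS -> v \in U ->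
  quotv_hom h U V U' V' (quotv_pi U V v) = quotv_pi U' V' (h v).
Proof.
move=> sU sV vU; rewrite /quotv_hom 2!comp_lfunE.
have -> : linfun (@vsval F vT (U :\: V)%VS) (quotv_pi U V v) =
    vsval (quotv_pi U V v) by apply: etrans (lfunE _ _) _.
apply/eqP; rewrite eq_sym -subr_eq0 -linearB -linearB /=.
have rU : vsval (quotv_pi U V v) \in U.
  by apply: (subvP (diffvSl U V)); apply: subvsP.
rewrite quotv_pi_eq0.
  by apply: (subvP sV); apply: memv_img; apply: quotv_pi_rep.
by apply: (subvP sU); apply: memv_img; rewrite rpredB.
Qed.

End Induced.

Section SublevelFacts.
Variables (F : fieldType) (R : realType) (X : filtered_space R) (k : nat).

Lemma sublevel_face_closed t : face_closed (sublevel X t).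
Proof.
move=> s u /[!inE] /andP[s0 st] us u0; rewrite u0 /=.
exact: le_trans (filtration_mono u0 us) st.
Qed.

Lemma sublevel_determined t : sublevel X t = finset.set0 \/
  exists2 r, r \in [seq filtration s | s : {set X}] &
    r <= t /\ sublevel X t = sublevel X r.
Proof.
have [->|[s0 s0t]] := set_0Vmem (sublevel X t); first by left.
right; have [s st smax] := arg_maxP (fun s : {set X} => filtration s) s0t.
exists (filtration s); first by apply: map_f; rewrite mem_enum.
have : s \in sublevel X t by [].
rewrite inE => /andP[_ le_st].
split=> //; apply/setP => u; rewrite !inE; case: eqP => //= /eqP u0.
apply/idP/idP => [ut|us]; last exact: le_trans us le_st.
have uX : u \in sublevel X t by rewrite inE u0.
exact: smax uX.
Qed.

Lemma simplex_span0 n : simplex_span F n (finset.set0 : {set {set X}}) = 0%VS.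
Proof.
apply/eqP; rewrite -subv0; apply/span_subvP => c /mapP[s].
by rewrite mem_filter mem_enum inE andbF.
Qed.

Lemma pers_homology_diagram : exists D, is_diagram (pers_homology F X k) D.
Proof.
apply: (@quotv_diagram F R _ (fun t => cycles F k (sublevel X t))
  (fun t => boundaries F k (sublevel X t)) [seq filtration s | s : {set X}]).
- by move=> s t st; apply/cycles_sub/sublevel_sub.
- by move=> s t st; apply/boundaries_sub/sublevel_sub.
- move=> t; have [->|[r rX [rt tr]]] := sublevel_determined t; last first.
    by right; exists r; rewrite // -tr.
  by left; rewrite /cycles /chains -/(simplex_span F k.+1 _) simplex_span0 cap0v.
- move=> t; have [->|[r rX [rt tr]]] := sublevel_determined t; last first.
    by right; exists r; rewrite // -tr.
  left; rewrite /boundaries /chains -/(simplex_span F k.+2 _).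
  by rewrite simplex_span0 limg0.
Qed.

End SublevelFacts.

Section ChainTransfer.
Variables (F : fieldType) (X Z : finType) (i : X -> Z) (phi : Z -> X).
Hypothesis iK : cancel i phi.
Hypothesis i_mono : forall x y,
  (enum_rank (i x) < enum_rank (i y))%N = (enum_rank x < enum_rank y)%N.
Local Notation chain T := {ffun {set T} -> F^o}.
Implicit Types (k : nat) (L : {set {set X}}).

Lemma push_chains k L c : c \in chains F k L ->
  push F i c \in chains F k (pullback phi L).
Proof.
move=> /(@simplex_spanP _ _ k.+1) cL; apply/(@simplex_spanP _ _ k.+1).
move=> t pt; have /(in_imageP iK)[s ts] := push_image pt; move: pt.
rewrite ts pushE (preimset_imset iK) eqxx => /cL[sL sk].
rewrite card_imset ?sk; last exact: can_inj iK.
by split=> //; apply: imset_pullback; rewrite // -card_gt0 sk.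
Qed.

Lemma push_cycles k L :
  (push F i @: cycles F k L <= cycles F k (pullback phi L))%VS.
Proof.
apply/subvP => _ /memv_imgP[c + ->]; rewrite !memv_cap !memv_ker.
move=> /andP[cL /eqP c0].
by rewrite push_chains //= -(push_boundary iK i_mono) c0 linear0.
Qed.

Lemma push_boundaries k L :
  (push F i @: boundaries F k L <= boundaries F k (pullback phi L))%VS.
Proof.
apply/subvP => _ /memv_imgP[_ /memv_imgP[c cL ->] ->].
by rewrite (push_boundary iK i_mono) memv_img // push_chains.
Qed.

Lemma pullback_equivalence : exists r : 'Hom(chain Z, chain X),
  [/\ forall c, r (push F i c) = c &
   forall L k, face_closed L ->
   [/\ (r @: cycles F k (pullback phi L) <= cycles F k L)%VS,
       (r @: boundaries F k (pullback phi L) <= boundaries F k L)%VS &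
      {in cycles F k (pullback phi L), forall d,
         push F i (r d) - d \in boundaries F k (pullback phi L)}]].
Proof.
have [r [r_push r_chains]] := pullback_retraction F iK i_mono.
exists r; split=> // L k fcL; have [r1 r2 r3] := r_chains L fcL k; split=> //.
  apply/subvP => _ /memv_imgP[c + ->]; rewrite !memv_cap !memv_ker.
  by move=> /andP[cL /eqP c0]; rewrite r1 //= -r2 // c0 linear0.
have [r1' r2' _] := r_chains L fcL k.+1.
apply/subvP => _ /memv_imgP[_ /memv_imgP[c cL ->] ->].
by rewrite r2' // memv_img // r1'.
Qed.

End ChainTransfer.

Lemma pullback_shift (R : realType) (Z : finType) (X Y : filtered_space R)
    (phi : Z -> X) (psi : Z -> Y) (e t : R) :
  (forall u : {set Z}, u != finset.set0 ->
     filtration (psi @: u) <= filtration (phi @: u) + e) ->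
  pullback phi (sublevel X t) \subset pullback psi (sublevel Y (t + e)).
Proof.
move=> shift; apply/subsetP => u /[!inE] /andP[u0 /andP[_ ut]]; rewrite u0 /=.
apply/andP; split.
  by apply/set0Pn; have /set0Pn[z zu] := u0; exists (psi z); apply: imset_f.
by apply: le_trans (shift u u0) _; rewrite lerD2r.
Qed.

Section ChainMaps.
Variables (F : fieldType) (R : realType) (e : R) (k : nat).
Hypothesis e0 : 0 <= e.
Implicit Types X Y : filtered_space R.

Local Notation chain T := {ffun {set T} -> F^o}.
Local Notation cycles_at X t := (cycles F k (sublevel X t)).
Local Notation boundaries_at X t := (boundaries F k (sublevel X t)).

Definition shifts_cycles X Y (h : 'Hom(chain X, chain Y)) := forall t,
  (h @: cycles_at X t <= cycles_at Y (t + e))%VS /\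
  (h @: boundaries_at X t <= boundaries_at Y (t + e))%VS.

Definition induced_shift X Y (h : 'Hom(chain X, chain Y)) t :
    'Hom(pobj (pers_homology F X k) t, pobj (pers_homology F Y k) (t + e)) :=
  quotv_hom h (cycles_at X t) (boundaries_at X t)
    (cycles_at Y (t + e)) (boundaries_at Y (t + e)).

Lemma homology_rep X t (x : pobj (pers_homology F X k) t) :
  exists2 c, c \in cycles_at X t &
    x = quotv_pi (cycles_at X t) (boundaries_at X t) c.
Proof.
exists (vsval x); last by rewrite quotv_piK.
by apply: (subvP (diffvSl (cycles_at X t) (boundaries_at X t))); apply: subvsP.
Qed.

Lemma pmap_rep X s t (st : s <= t) c : c \in cycles_at X s ->
  pmap (pers_homology F X k) st
    (quotv_pi (cycles_at X s) (boundaries_at X s) c) =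
  quotv_pi (cycles_at X t) (boundaries_at X t) c.
Proof.
move=> cX; apply: quotv_mapE => //.
  by apply/cycles_sub/sublevel_sub.
by apply/boundaries_sub/sublevel_sub.
Qed.

Lemma induced_rep X Y (h : 'Hom(chain X, chain Y)) t c :
  shifts_cycles h -> c \in cycles_at X t ->
  induced_shift h t (quotv_pi (cycles_at X t) (boundaries_at X t) c) =
  quotv_pi (cycles_at Y (t + e)) (boundaries_at Y (t + e)) (h c).
Proof. by move=> hS cX; have [h1 h2] := hS t; apply: quotv_homE. Qed.

Lemma induced_shift_morphism X Y (h : 'Hom(chain X, chain Y)) :
  shifts_cycles h -> shift_morphism (induced_shift h).
Proof.
move=> hS s t st st' x; have [c cX ->] := homology_rep x.
have cXt : c \in cycles_at X t.
  by apply: subvP cX; apply/cycles_sub/sublevel_sub.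
rewrite pmap_rep // !induced_rep // pmap_rep //.
by have [h1 _] := hS s; apply: (subvP h1); apply: memv_img.
Qed.

Lemma induced_half_inverse X Y (h : 'Hom(chain X, chain Y))
    (h' : 'Hom(chain Y, chain X)) :
  shifts_cycles h -> shifts_cycles h' ->
  (forall t c, c \in cycles_at X t ->
     h' (h c) - c \in boundaries_at X (t + e + e)) ->
  half_inverse (induced_shift h) (induced_shift h').
Proof.
move=> hS hS' hh' t tt x; have [c cX ->] := homology_rep x.
have hc : h c \in cycles_at Y (t + e).
  by have [h1 _] := hS t; apply: (subvP h1); apply: memv_img.
have hhc : h' (h c) \in cycles_at X (t + e + e).
  by have [h1 _] := hS' (t + e); apply: (subvP h1); apply: memv_img.
have cXt : c \in cycles_at X (t + e + e).
  by apply: subvP cX; apply/cycles_sub/sublevel_sub.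
rewrite pmap_rep // !induced_rep //; apply/eqP; rewrite -subr_eq0 -linearB /=.
by rewrite quotv_pi_eq0 ?(hh' t) // rpredB.
Qed.

End ChainMaps.

Section Interleaving.
Variables (F : fieldType) (R : realType) (e : R) (Z : finType) (k : nat).
Local Notation chain T := {ffun {set T} -> F^o}.

Lemma push_retract_shifts (X Y : filtered_space R) (i : X -> Z) (phi : Z -> X)
    (psi : Z -> Y) (r : 'Hom(chain Z, chain Y)) :
  cancel i phi ->
  (forall x y,
    (enum_rank (i x) < enum_rank (i y))%N = (enum_rank x < enum_rank y)%N) ->
  (forall t, pullback phi (sublevel X t) \subset
     pullback psi (sublevel Y (t + e))) ->
  (forall t, (r @: cycles F k (pullback psi (sublevel Y t)) <=
      cycles F k (sublevel Y t))%VS /\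
    (r @: boundaries F k (pullback psi (sublevel Y t)) <=
      boundaries F k (sublevel Y t))%VS) ->
  shifts_cycles e k (r \o push F i)%VF.
Proof.
move=> iK i_mono XY rY t; have [rc rb] := rY (t + e); rewrite !limg_comp; split.
  apply: subv_trans rc; apply: limgS.
  by apply: subv_trans (push_cycles F iK i_mono _ _) _; apply: cycles_sub.
apply: subv_trans rb; apply: limgS.
by apply: subv_trans (push_boundaries F iK i_mono _ _) _; apply: boundaries_sub.
Qed.

(** [push (r' (push c))] and [push c] differ by a boundary of the complex pulled
    back from [Y], which lies in the one pulled back from [X] at a later time;
    [r] turns it into a boundary in [X], and [push c] into [c]. *)
Lemma round_trip (X Y : filtered_space R) (i : X -> Z) (phi : Z -> X)
    (j : Y -> Z) (psi : Z -> Y) (r : 'Hom(chain Z, chain X))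
    (r' : 'Hom(chain Z, chain Y)) :
  cancel i phi ->
  (forall x y,
    (enum_rank (i x) < enum_rank (i y))%N = (enum_rank x < enum_rank y)%N) ->
  (forall t, pullback phi (sublevel X t) \subset
     pullback psi (sublevel Y (t + e))) ->
  (forall t, pullback psi (sublevel Y t) \subset
     pullback phi (sublevel X (t + e))) ->
  (forall c, r (push F i c) = c) ->
  (forall t, (r @: boundaries F k (pullback phi (sublevel X t)) <=
      boundaries F k (sublevel X t))%VS) ->
  (forall t, {in cycles F k (pullback psi (sublevel Y t)), forall d,
     push F j (r' d) - d \in boundaries F k (pullback psi (sublevel Y t))}) ->
  forall t c, c \in cycles F k (sublevel X t) ->
    (r \o push F j)%VF ((r' \o push F i)%VF c) - c
      \in boundaries F k (sublevel X (t + e + e)).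
Proof.
move=> iK i_mono XY YX r_push rb rY t c cX; rewrite !comp_lfunE.
rewrite -[X in _ - X]r_push -linearB /=.
apply: (subvP (rb (t + e + e))); apply: memv_img.
apply: (subvP (boundaries_sub F k (YX (t + e)))); apply: rY.
apply: (subvP (cycles_sub F k (XY t))).
by apply: (subvP (push_cycles F iK i_mono _ _)); apply: memv_img.
Qed.

Variables (X Y : filtered_space R).
Variables (i : X -> Z) (phi : Z -> X) (j : Y -> Z) (psi : Z -> Y).
Hypotheses (iK : cancel i phi) (jK : cancel j psi).
Hypothesis i_mono : forall x y,
  (enum_rank (i x) < enum_rank (i y))%N = (enum_rank x < enum_rank y)%N.
Hypothesis j_mono : forall x y,
  (enum_rank (j x) < enum_rank (j y))%N = (enum_rank x < enum_rank y)%N.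
Hypothesis e0 : 0 <= e.
Hypothesis close_filtrations : forall u : {set Z}, u != finset.set0 ->
  `|filtration (phi @: u) - filtration (psi @: u)| <= e.

(** Two close filtrations of [Z] have interleaved sublevel complexes, by
    inclusions, and these compute the homology of [X] and of [Y]. *)
Lemma pers_homology_interleaved :
  interleaved e (pers_homology F X k) (pers_homology F Y k).
Proof.
have [r [r_push rL]] := pullback_equivalence F iK i_mono.
have [r' [r'_push rL']] := pullback_equivalence F jK j_mono.
have shift u : u != finset.set0 ->
    filtration (psi @: u) <= filtration (phi @: u) + e /\
    filtration (phi @: u) <= filtration (psi @: u) + e.
  by move=> /close_filtrations; rewrite ler_distl; lra.
have XY t := pullback_shift t (fun u u0 => proj1 (shift u u0)).
have YX t := pullback_shift t (fun u u0 => proj2 (shift u u0)).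
have fX t := rL _ k (@sublevel_face_closed R X t).
have fY t := rL' _ k (@sublevel_face_closed R Y t).
have S : shifts_cycles e k (r' \o push F i)%VF.
  by apply: push_retract_shifts iK i_mono XY _ => t; have [] := fY t.
have S' : shifts_cycles e k (r \o push F j)%VF.
  by apply: push_retract_shifts jK j_mono YX _ => t; have [] := fX t.
exists (fun t => induced_shift e k (r' \o push F i)%VF t).
exists (fun t => induced_shift e k (r \o push F j)%VF t).
split; [exact: induced_shift_morphism|exact: induced_shift_morphism| |].
  apply: induced_half_inverse => //.
  apply: (round_trip iK i_mono XY YX) => //.
    by move=> t; have [] := fX t.
  by move=> t; have [] := fY t.
apply: induced_half_inverse => //.
apply: (round_trip jK j_mono YX XY) => //.
  by move=> t; have [] := fY t.
by move=> t; have [] := fX t.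
Qed.

End Interleaving.

(** * The enumeration order of a disjoint sum *)

Lemma enum_sum (A B : finType) :
  enum {: A + B} = [seq inl x | x <- enum A] ++ [seq inr y | y <- enum B].
Proof. by rewrite !enumT [in LHS]unlock. Qed.

Lemma enum_rank_val (T : finType) (x : T) : enum_rank x = index x (enum T) :> nat.
Proof.
by rewrite -[in RHS](enum_rankK x) /enum_val index_uniq ?enum_uniq -?cardE.
Qed.

Lemma enum_rank_inl (A B : finType) (x y : A) :
  (enum_rank (inl x : A + B) < enum_rank (inl y : A + B))%N =
  (enum_rank x < enum_rank y)%N.
Proof.
rewrite !enum_rank_val !enum_sum !index_cat !mem_map; try by move=> ? ? [].
by rewrite -!enumT !mem_enum !index_map //; move=> ? ? [].
Qed.

Lemma enum_rank_inr (A B : finType) (x y : B) :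
  (enum_rank (inr x : A + B) < enum_rank (inr y : A + B))%N =
  (enum_rank x < enum_rank y)%N.
Proof.
have inl_inr (z : B) : (inr z : A + B) \notin [seq inl x | x <- enum A].
  by apply/negP => /mapP[].
rewrite !enum_rank_val !enum_sum !index_cat !(negPf (inl_inr _)) ltn_add2l.
by rewrite !index_map //; move=> ? ? [].
Qed.

(** * Stability *)

Section Main.
Variables (F : fieldType) (R : realType) (X Y : filtered_space R) (k : nat).

Lemma pdiagramP (T : filtered_space R) :
  is_diagram (pers_homology F T k) (pdiagram F T k).
Proof. exact: xgetPex (pers_homology_diagram F T k). Qed.

(** Sections of the two surjections replace the parametrization by the disjoint
    sum of [X] and [Y], into which both embed monotonically for the enumeration
    orders, without increasing the distortion. *)
Lemma bottleneck_le_distortion (Z : finType) (phiX : Z -> X) (phiY : Z -> Y) :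
  surjective phiX -> surjective phiY ->
  (bottleneck (pdiagram F X k) (pdiagram F Y k) <= (distortion phiX phiY)%:E)%E.
Proof.
move=> /fin_all_exists[sX sXK] /fin_all_exists[sY sYK].
set e := distortion phiX phiY.
have e0 : 0 <= e by apply: bigmax_ge_id.
pose s (z : X + Y) : Z := match z with inl x => sX x | inr y => sY y end.
apply: (@interleaved_bottleneck F R e e0 _ _ _ _ (pdiagramP X) (pdiagramP Y)).
apply: (@pers_homology_interleaved F R e _ k X Y
  inl (phiX \o s) inr (phiY \o s)) => //.
- exact: enum_rank_inl.
- exact: enum_rank_inr.
move=> u u0.
rewrite (imset_comp phiX s u) (imset_comp phiY s u).
apply: (le_bigmax_cond _ (fun t : {set Z} =>
  `|filtration (phiX @: t) - filtration (phiY @: t)|)).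
by have /set0Pn[z zu] := u0; apply/set0Pn; exists (s z); apply: imset_f.
Qed.

End Main.

Theorem theorem4p2 (F : fieldType) (R : realType) (X Y : filtered_space R)
  (k : nat) :
  (bottleneck (pdiagram F X k) (pdiagram F Y k) <= (filtered_dist X Y)%:E)%E.
Proof.
have dist_ge (Z : finType) (phiX : Z -> X) (phiY : Z -> Y) :=
  @bottleneck_le_distortion F R X Y k Z phiX phiY.
have /card_gt0P[x0 _] := points_gt0 X; have /card_gt0P[y0 _] := points_gt0 Y.
have surj1 : surjective (@fst X Y) by move=> x; exists (x, y0).
have surj2 : surjective (@snd X Y) by move=> y; exists (x0, y).
set b := bottleneck _ _ in dist_ge *.
case bE : b => [c| |]; last by rewrite leNye.
- rewrite lee_fin; apply: lb_le_inf.
    by exists (distortion (@fst X Y) (@snd X Y)), (X * Y)%type, fst, snd.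
  by move=> _ [Z [phiX [phiY [sX sY ->]]]]; rewrite -lee_fin -bE dist_ge.
- by have := dist_ge _ _ _ surj1 surj2; rewrite bE.
Qed.
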